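(* Let $\mu_1$ be a quasi-character of $E^\times$, $\mu_2$ a character of $E^1$, and let $\pi=\mathrm{Ind}_B^G(\mu_1\otimes\mu_2)$ be the (normalized) parabolically induced representation of $G$, with space $V$ ($\pi$ is not assumed irreducible). Then: (i) The conductor of $\pi$ is $N_\pi=2c(\mu_1)+c(\mu_2)$. (ii) For every integer $n\geq N_\pi$, the functions $f_{n,i}$, where $i$ runs over the integers with $\frac{n+c(\mu_2)}{2}\leq i\leq n-c(\mu_1)$, constitute a basis for $V(n)$. In particular, \[ \dim V(n)=\left\lfloor\frac{n-N_\pi}{2}\right\rfloor+1 . \]
   Context: $F$ is a non-archimedean local field of characteristic zero with odd residual characteristic; $E$ is the unramified quadratic extension of $F$, with ring of integers $\mathfrak{o}_E$ and maximal ideal $\mathfrak{p}_E$; $\varpi$ is a uniformizer of $F$ (hence of $E$); $|\cdot|_E$ is the normalized absolute value of $E$; $x\mapsto\overline{x}$ is the non-trivial element of $\mathrm{Gal}(E/F)$. $G=\{g\in \mathrm{GL}_3(E) : {}^t\overline{g}Jg=J\}$ with $J=\begin{pmatrix}0&0&1\\0&1&0\\1&0&0\end{pmatrix}$. $E^1$ is the norm-one subgroup of $E^\times$. $B$ is the group of upper triangular elements of $G$, $T$ its diagonal subgroup, $U$ its unipotent radical. $\mu=\mu_1\otimes\mu_2$ is the quasi-character $\mathrm{diag}(a,b,\overline{a}^{-1})\mapsto\mu_1(a)\mu_2(b)$ of $T$ ($a\in E^\times$, $b\in E^1$), extended to $B$ trivially on $U$. $\mathrm{Ind}_B^G\mu$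 is the space of locally constant $f:G\to\mathbf{C}$ with $f(bg)=\delta_B(b)^{1/2}\mu(b)f(g)$ for $b\in B$, $g\in G$, with $G$ acting by right translation, where $\delta_B(\mathrm{diag}(a,b,\overline{a}^{-1}))=|a|_E^2$. Conductors of characters: $c(\mu_1)=\min\{n\ge0: \mu_1|_{(1+\mathfrak{p}_E^n)\cap\mathfrak{o}_E^\times}=1\}$, and $c(\mu_2)=\min\{n\ge0:\mu_2|_{E^1_n}=1\}$ where $E^1_0=E^1$, $E^1_n=E^1\cap(1+\mathfrak{p}_E^n)$ for $n\geq1$. For $n\ge 0$ let \[K_n=\begin{pmatrix}\mathfrak{o}_E&\mathfrak{o}_E&\mathfrak{p}_E^{-n}\\ \mathfrak{p}_E^n&1+\mathfrak{p}_E^n&\mathfrak{o}_E\\ \mathfrak{p}_E^n&\mathfrak{p}_E^n&\mathfrak{o}_E\end{pmatrix}\cap G .\] For a smooth representation $(\pi,V)$, $V(n)$ is the space of $K_n$-fixed vectors; if some $V(n)$ is non-zero, the conductor of $\pi$ is $N_\pi=\min\{n\ge0: V(n)\neq\{0\}\}$. For an integer $i$, $\gamma_i=\begin{pmatrix}1&&\\ \varpi^i&1&\\ -\varpi^{2i}/2&-\varpi^i&1\end{pmatrix}\in G$. For $\lceil n/2\rceil\le i\le n$, $f_{n,i}$ denotes the function in $V(n)$ with $f_{n,i}(\gamma_i)=1$ and $\mathrm{supp}\, f_{n,i}=B\gamma_iK_n$; it is well defined exactly when $c(\mu_2)\le 2i-n$ and $c(\mu_1)\le n-i$. *)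

(* Defs.v *)
From HB Require Import structures.
From mathcomp Require Import all_boot all_order all_algebra all_field.
From mathcomp Require Import ring.
From mathcomp Require Import finmap all_classical reals.
From mathcomp Require Import complex.

Set Implicit Arguments.
Unset Strict Implicit.
Unset Printing Implicit Defensive.

Import Order.TTheory GRing.Theory Num.Theory.

Local Open Scope classical_set_scope.
Local Open Scope ring_scope.
Local Open Scope complex_scope.

(* [v] is a normalized (surjective onto Z) discrete valuation; the value [v 0]
   is junk and is never used. *)
Definition discrete_valuation (K : fieldType) (v : K -> int) : Prop :=
  [/\ forall x y, x != 0 -> y != 0 -> v (x * y) = v x + v y,
      forall x y, x != 0 -> y != 0 -> x + y != 0 ->
        Num.min (v x) (v y) <= v (x + y)
    & forall n : int, exists2 x, x != 0 & v x = n].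

(* The fractional ideal p^n; in particular [pideal v 0] is the ring of integers
   and [pideal v 1] the maximal ideal. *)
Definition pideal (K : fieldType) (v : K -> int) (n : int) : set K :=
  [set x | x = 0 \/ n <= v x].

Definition integer_units (K : fieldType) (v : K -> int) : set K :=
  [set x | x != 0 /\ v x = 0].

Definition uniformizer (K : fieldType) (v : K -> int) (w : K) : Prop :=
  w != 0 /\ v w = 1.

Definition complete_valuation (K : fieldType) (v : K -> int) : Prop :=
  forall u : nat -> K,
    (forall m : int, exists N : nat, forall i j : nat,
       (N <= i)%N -> (N <= j)%N -> pideal v m (u i - u j)) ->
    exists l : K, forall m : int, exists N : nat, forall i : nat,
      (N <= i)%N -> pideal v m (u i - l).

(* The residue field o/p, as the set of cosets x + p with x in o. *)
Definition residue_classes (K : fieldType) (v : K -> int) : set (set K) :=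
  [set [set y | pideal v 1 (y - x)] | x in pideal v 0].

Definition residue_card (K : fieldType) (v : K -> int) : nat :=
  #|` fset_set (residue_classes v)|%fset.

Definition local_field (K : fieldType) (v : K -> int) : Prop :=
  [/\ discrete_valuation v, complete_valuation v
    & finite_set (residue_classes v)].

(* [p] is the characteristic of the residue field: p = 0 in o/p. *)
Definition residue_pchar (K : fieldType) (v : K -> int) (p : nat) : Prop :=
  prime p /\ pideal v 1 p%:R.

(* The normalized valuation of [E] extends that of [F], i.e. the ramification
   index is 1.  (Residue extensions of local fields are always separable.) *)
Definition unramified (F : fieldType) (vF : F -> int) (E : fieldExtType F)
    (vE : E -> int) : Prop :=
  forall x : F, x != 0 -> vE x%:A = vF x.

Definition absval (R : realType) (K : fieldType) (v : K -> int) (x : K) : R :=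
  if x == 0 then 0 else (residue_card v)%:R ^ (- v x).

(* The least element of [A], and 0 if [A] is empty. *)
Definition nat_min (A : set nat) : nat :=
  xget 0%N [set n | A n /\ forall m, A m -> (n <= m)%N].

Lemma nat_minP (A : set nat) : A !=set0 ->
  A (nat_min A) /\ forall m, A m -> (nat_min A <= m)%N.
Proof.
move=> [n An]; rewrite /nat_min; case: xgetP => [m _ // | noA].
have ex : exists m, `[<A m>] by exists n; apply/asboolP.
case: (noA (ex_minn ex)); case: ex_minnP => m /asboolP Am mmin /=.
by split=> // k Ak; apply: mmin; apply/asboolP.
Qed.

(* A continuous homomorphism from the subgroup [A] of K^* to C^*; values of
   [chi] outside [A] are irrelevant. *)
Definition quasi_character (R : realType) (K : fieldType) (v : K -> int)
    (A : set K) (chi : K -> R[i]) : Prop :=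
  [/\ forall x, A x -> chi x != 0,
      forall x y, A x -> A y -> chi (x * y) = chi x * chi y
    & forall x, A x -> forall e : R, 0 < e -> exists m : int,
        forall y, A y -> pideal v m (y - x) -> `|chi y - chi x| < e%:C].

Definition norm_one (K : fieldType) (conj : K -> K) : set K :=
  [set x | x * conj x = 1].

Definition conductor1 (R : realType) (K : fieldType) (v : K -> int)
    (mu1 : K -> R[i]) : nat :=
  nat_min [set n | forall x,
    pideal v n%:Z (x - 1) -> integer_units v x -> mu1 x = 1].

Definition norm_one_filtration (K : fieldType) (v : K -> int) (conj : K -> K)
    (n : nat) : set K :=
  if n == 0%N then norm_one conj
  else norm_one conj `&` [set x | pideal v n%:Z (x - 1)].

Definition conductor2 (R : realType) (K : fieldType) (v : K -> int)
    (conj : K -> K) (mu2 : K -> R[i]) : nat :=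
  nat_min [set n | forall x, norm_one_filtration v conj n x -> mu2 x = 1].

Definition J3 (K : fieldType) : 'M[K]_3 := \matrix_(i, j) (j == rev_ord i)%:R.

Definition unitary3 (K : fieldType) (conj : {rmorphism K -> K}) :
    pred 'M[K]_3 :=
  fun g => (g \in unitmx) && ((map_mx conj g)^T *m J3 K *m g == J3 K).

Definition U3 (K : fieldType) (conj : {rmorphism K -> K}) :=
  {g : 'M[K]_3 | unitary3 conj g}.

HB.instance Definition _ (K : fieldType) (conj : {rmorphism K -> K}) :=
  SubChoice.on (U3 conj).

Coercion U3_mx (K : fieldType) (conj : {rmorphism K -> K}) (g : U3 conj) :
  'M[K]_3 := val g.

Section U3Group.
Context (K : fieldType) (conj : {rmorphism K -> K}).
Implicit Types g h : U3 conj.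

Lemma U3_one_subproof : unitary3 conj 1%:M.
Proof. by rewrite /unitary3 unitmx1 map_mx1 trmx1 mul1mx mulmx1 eqxx. Qed.

Lemma U3_mul_subproof g h : unitary3 conj (val g *m val h).
Proof.
case/andP: (valP g) => gu /eqP gJ; case/andP: (valP h) => hu /eqP hJ.
rewrite /unitary3 unitmx_mul gu hu /= map_mxM trmx_mul.
by rewrite !mulmxA -[_ *m _ *m J3 K]mulmxA -[_ *m (_ *m J3 K) *m _]mulmxA gJ hJ.
Qed.

Lemma U3_inv_subproof g : unitary3 conj (invmx (val g)).
Proof.
case/andP: (valP g) => gu /eqP gJ.
rewrite /unitary3 unitmx_inv gu /=; apply/eqP.
rewrite -[in LHS]gJ !mulmxA -trmx_mul -map_mxM mulmxV //.
by rewrite map_mx1 trmx1 mul1mx -mulmxA mulmxV // mulmx1.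
Qed.

Definition U3_one : U3 conj := Sub 1%:M U3_one_subproof.
Definition U3_mul g h : U3 conj := Sub (val g *m val h) (U3_mul_subproof g h).
Definition U3_inv g : U3 conj := Sub (invmx (val g)) (U3_inv_subproof g).

Lemma U3_mulA : associative U3_mul.
Proof. by move=> g h k; apply: val_inj; rewrite /= mulmxA. Qed.
Lemma U3_mul1g : left_id U3_one U3_mul.
Proof. by move=> g; apply: val_inj; rewrite /= mul1mx. Qed.
Lemma U3_mulg1 : right_id U3_one U3_mul.
Proof. by move=> g; apply: val_inj; rewrite /= mulmx1. Qed.
Lemma U3_mulVg : left_inverse U3_one U3_inv U3_mul.
Proof.
by move=> g; apply: val_inj; rewrite /= mulVmx //; case/andP: (valP g).
Qed.
Lemma U3_mulgV : right_inverse U3_one U3_inv U3_mul.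
Proof.
by move=> g; apply: val_inj; rewrite /= mulmxV //; case/andP: (valP g).
Qed.

HB.instance Definition _ := isGroup.Build (U3 conj)
  U3_mulA U3_mul1g U3_mulg1 U3_mulVg U3_mulgV.

End U3Group.

Definition borel (K : fieldType) (conj : {rmorphism K -> K}) :
    set (U3 conj) :=
  [set b : U3 conj | forall i j : 'I_3, (j < i)%N -> b i j = 0].
Arguments borel {K} conj _.

(* The value at [b] in B of the character of B that is trivial on U and maps
   diag(a, b, conj a ^-1) to |a|_E ^ 2: [b] has the diagonal of its T-part. *)
Definition modulusB (R : realType) (K : fieldType) (v : K -> int)
    (conj : {rmorphism K -> K}) (b : U3 conj) : R :=
  absval R v (b 0 0) ^+ 2.

(* Likewise for mu1 (x) mu2, extended to B trivially on U. *)
Definition muB (R : realType) (K : fieldType) (conj : {rmorphism K -> K})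
    (mu1 mu2 : K -> R[i]) (b : U3 conj) : R[i] :=
  mu1 (b 0 0) * mu2 (b 1 1).

Definition locally_constant (R : realType) (K : fieldType) (v : K -> int)
    (conj : {rmorphism K -> K}) (f : U3 conj -> R[i]^o) : Prop :=
  forall g : U3 conj, exists m : int, forall h : U3 conj,
    (forall i j : 'I_3, pideal v m (h i j - g i j)) -> f h = f g.

Definition induced (R : realType) (K : fieldType) (v : K -> int)
    (conj : {rmorphism K -> K}) (mu1 mu2 : K -> R[i]) :
    set (U3 conj -> R[i]^o) :=
  [set f | locally_constant v f /\
    forall b g : U3 conj, borel conj b ->
      f (b * g)%g = (Num.sqrt (modulusB R v b))%:C * muB mu1 mu2 b * f g].
Arguments induced {R K} v conj mu1 mu2 _.

Definition right_translation (R : realType) (K : fieldType)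
    (conj : {rmorphism K -> K}) (g : U3 conj) (f : U3 conj -> R[i]^o) :
    U3 conj -> R[i]^o :=
  fun x => f (x * g)%g.

Definition Kgroup (K : fieldType) (v : K -> int) (conj : {rmorphism K -> K})
    (n : nat) : set (U3 conj) :=
  [set g : U3 conj | let m : 'M[K]_3 := g in
    [/\ [/\ pideal v 0 (m 0 0), pideal v 0 (m 0 1) & pideal v (- n%:Z) (m 0 2)],
        [/\ pideal v n%:Z (m 1 0), pideal v n%:Z (m 1 1 - 1)
          & pideal v 0 (m 1 2)]
      & [/\ pideal v n%:Z (m 2 0), pideal v n%:Z (m 2 1)
          & pideal v 0 (m 2 2)]]].
Arguments Kgroup {K} v conj n _.

Definition fixed_vectors (R : realType) (K : fieldType) (v : K -> int)
    (conj : {rmorphism K -> K}) (V : set (U3 conj -> R[i]^o)) (n : nat) :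
    set (U3 conj -> R[i]^o) :=
  [set f | V f /\ forall k, Kgroup v conj n k -> right_translation k f = f].

Definition rep_conductor (R : realType) (K : fieldType) (v : K -> int)
    (conj : {rmorphism K -> K}) (V : set (U3 conj -> R[i]^o)) : nat :=
  nat_min [set n | fixed_vectors v V n <> [set 0]].

Definition gamma_mx (K : fieldType) (w : K) (i : int) : 'M[K]_3 :=
  \matrix_(k < 3, l < 3) nth 0 (nth [::]
    [:: [:: 1;                     0;         0];
        [:: w ^ i;                 1;         0];
        [:: - (w ^ (2 * i) / 2%:R); - (w ^ i); 1]] k) l.

(* [gamma_mx w i] as an element of G; see [val_gamma]. *)
Definition gamma (K : fieldType) (conj : {rmorphism K -> K}) (w : K)
    (i : int) : U3 conj :=
  insubd (1%g : U3 conj) (gamma_mx w i).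

Lemma gamma_unitary (K : fieldType) (conj : {rmorphism K -> K}) (w : K)
    (i : int) : 2%:R != 0 :> K -> w != 0 -> conj w = w ->
  unitary3 conj (gamma_mx w i).
Proof.
move=> K2 w0 cw; have cwi j : conj (w ^ j) = w ^ j by rewrite fmorphXz cw.
have wD : w ^ (2 * i) = w ^ i * w ^ i by rewrite -expfzDr // -mulr2n mulr_natl.
have eqJ : (map_mx conj (gamma_mx w i))^T *m J3 K *m gamma_mx w i = J3 K.
  apply/matrixP => k l; rewrite !mxE !big_ord_recl big_ord0 !mxE /=.
  rewrite !big_ord_recl !big_ord0 !mxE /=.
  case: k => [[|[|[|//]]] kP]; case: l => [[|[|[|//]]] lP] /=;
    rewrite ?(rmorphN, rmorph0, rmorph1, rmorphM, fmorphV, rmorph_nat, cwi) /=;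
    rewrite ?wD -?val_eqE /=; by field.
rewrite /unitary3 eqJ eqxx andbT unitmxE unitfE.
apply/eqP => d0; have /(congr1 determinant) := eqJ.
rewrite !det_mulmx d0 mulr0 => /esym dJ.
have JJ : J3 K *m J3 K = 1%:M.
  apply/matrixP => k l; rewrite !mxE !big_ord_recl big_ord0 !mxE /=.
  by case: k => [[|[|[|//]]] kP]; case: l => [[|[|[|//]]] lP] /=;
    rewrite -?val_eqE /= ?(mulr0, mul0r, mulr1, addr0, add0r).
have /(congr1 determinant) := JJ.
by rewrite det_mulmx dJ mul0r det1 => /esym/eqP; rewrite oner_eq0.
Qed.

Lemma val_gamma (K : fieldType) (conj : {rmorphism K -> K}) (w : K)
    (i : int) : 2%:R != 0 :> K -> w != 0 -> conj w = w ->
  gamma conj w i = gamma_mx w i :> 'M_3.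
Proof. by move=> *; rewrite /U3_mx insubdK //; apply: gamma_unitary. Qed.

Definition is_fni (R : realType) (K : fieldType) (v : K -> int)
    (conj : {rmorphism K -> K}) (mu1 mu2 : K -> R[i]) (w : K)
    (n : nat) (i : int) (f : U3 conj -> R[i]^o) : Prop :=
  [/\ fixed_vectors v (induced v conj mu1 mu2) n f,
      f (gamma conj w i) = 1
    & [set g | f g != 0] =
      [set (b * gamma conj w i * k)%g | b in borel conj & k in Kgroup v conj n]].

Lemma is_fni_uniq (R : realType) (K : fieldType) (v : K -> int)
    (conj : {rmorphism K -> K}) (mu1 mu2 : K -> R[i]) (w : K)
    (n : nat) (i : int) (f f' : U3 conj -> R[i]^o) :
  is_fni v mu1 mu2 w n i f -> is_fni v mu1 mu2 w n i f' -> f = f'.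
Proof.
move=> [[[_ fB] fK] f1 fS] [[[_ fB'] fK'] f1' fS'].
apply/funext => g.
have [/= [b Bb [k Kk <-]]|gS] :=
  pselect ([set (b * gamma conj w i * k)%g | b in borel conj & k in Kgroup v conj n] g).
  have := congr1 (@^~ (b * gamma conj w i)%g) (fK k Kk).
  have := congr1 (@^~ (b * gamma conj w i)%g) (fK' k Kk).
  by rewrite /right_translation => -> ->; rewrite fB // fB' // f1 f1'.
have /negP/negPn/eqP -> : ~ (f g != 0) by move=> ?; apply: gS; rewrite -fS.
by have /negP/negPn/eqP -> : ~ (f' g != 0) by move=> ?; apply: gS; rewrite -fS'.
Qed.

(* The function f_{n,i} (unique by [is_fni_uniq]), and 0 if there is none. *)
Definition fni (R : realType) (K : fieldType) (v : K -> int)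
    (conj : {rmorphism K -> K}) (mu1 mu2 : K -> R[i]) (w : K)
    (n : nat) (i : int) : U3 conj -> R[i]^o :=
  xget 0 [set f | is_fni v mu1 mu2 w n i f].
Arguments fni {R K} v conj mu1 mu2 w n i _.

(* The family (e i) indexed by i in A is a basis of the subspace W. *)
Definition is_basis (K : fieldType) (V : lmodType K) (W : set V)
    (I : choiceType) (A : set I) (e : I -> V) : Prop :=
  [/\ forall i, A i -> W (e i),
      forall (s : seq I) (a : I -> K), uniq s -> (forall i, i \in s -> A i) ->
        \sum_(i <- s) a i *: e i = 0 -> forall i, i \in s -> a i = 0
    & forall x, W x -> exists (s : seq I) (a : I -> K),
        (forall i, i \in s -> A i) /\ x = \sum_(i <- s) a i *: e i].

Definition has_dim (K : fieldType) (V : lmodType K) (W : set V) (d : nat) :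
    Prop :=
  exists e : 'I_d -> V, is_basis W [set: 'I_d] e.

(* Main.v *)
(** Sending g to its bottom row identifies B \ G with the isotropic lines of E^3.
    If such a line is scaled to be primitive in the lattice
    (p^n, o, o), which K_n preserves, then min(v(y), n) for its middle coordinate y
    is invariant under K_n, and this invariant classifies the K_n-orbits: G is the
    disjoint union of the B gamma_i K_n with n/2 <= i <= n.  A K_n-fixed vector is
    therefore determined by its values at the gamma_i, and the value at gamma_i may
    be non-zero exactly when the inducing character is trivial on the torus part of
    B :&: gamma_i K_n gamma_i^-1, which consists of the diag(a, d, conj a ^-1)
    with a a unit in 1 + p^(n-i) and d in E^1_(2i-n): this is c(mu1) <= n - i
    and c(mu2) <= 2i - n. *)

Require Import Defs.
From mathcomp Require Import all_boot all_order all_algebra all_field.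
From mathcomp Require Import ring lra zify.
From mathcomp Require Import finmap all_classical reals.
From mathcomp Require Import complex.

Import Order.TTheory GRing.Theory Num.Theory.

Local Open Scope classical_set_scope.
Local Open Scope ring_scope.
Local Open Scope complex_scope.

Set Implicit Arguments.
Unset Strict Implicit.
Unset Printing Implicit Defensive.

(** * Discrete valuations *)

(** The definitions have default values, so some standard facts must be secured before orbits can be
    studied. Invariance of [vE] under [conj] is not assumed: it is drawn from the completeness of
    [F]. [residue_card] is 0 for an infinite residue field, and the modulus character could then
    vanish, so finiteness is carried from [F] to [E]. [nat_min] is 0 on the empty set, so the
    conductors are meaningful only because C^* has no small subgroups. Odd residual characteristic
    makes 2 a unit, which keeps the corner -w^(2i)/2 of gamma_i in p^n when n <= 2i. As the
    extension is unramified, w can be taken in [F], hence fixed by [conj]. The level 2i - n of d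
    comes from the corner p^(-n) of K_n, which conjugation by gamma_i shifts by w^(2i). *)

Section Valuation.
Context (K : fieldType) (v : K -> int) (v_val : discrete_valuation v).
Implicit Types (x y z : K) (m n : int).

Lemma valM x y : x != 0 -> y != 0 -> v (x * y) = v x + v y.
Proof. by case: v_val => + _ _; apply. Qed.

Lemma val1 : v 1 = 0.
Proof.
have : v (1 * 1) = v 1 + v 1 by apply: valM; exact: oner_neq0.
by rewrite mulr1; lia.
Qed.

Lemma valV x : x != 0 -> v x^-1 = - v x.
Proof. by move=> x0; have := valM x0 (invr_neq0 x0); rewrite divff // val1; lia. Qed.

Lemma valN x : v (- x) = v x.
Proof.
have [->|x0] := eqVneq x 0; first by rewrite oppr0.
have n1 : (-1 : K) != 0 by rewrite oppr_eq0 oner_neq0.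
have := valM n1 n1; rewrite mulrNN mulr1 val1 => vN1.
by rewrite -mulN1r valM //; lia.
Qed.

Lemma valX x (n : nat) : x != 0 -> v (x ^+ n) = v x * n%:Z.
Proof.
move=> x0; elim: n => [|n IHn]; first by rewrite expr0 val1 mulr0.
by rewrite exprS valM ?expf_neq0 // IHn; lia.
Qed.

Lemma valXz x n : x != 0 -> v (x ^ n) = v x * n.
Proof.
move=> x0; case: n => n; first by rewrite -exprnP valX.
by rewrite NegzE -exprnN valV ?expf_neq0 // valX //; lia.
Qed.

Lemma pideal0 n : pideal v n 0. Proof. by left. Qed.

Lemma pideal1 : pideal v 0 1. Proof. by right; rewrite val1. Qed.

Lemma pidealP n x : x != 0 -> pideal v n x <-> n <= v x.
Proof. by move=> x0; split=> [[/eqP|//]|]; [rewrite (negPf x0)|right]. Qed.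

Lemma pidealW m n x : n <= m -> pideal v m x -> pideal v n x.
Proof. by move=> nm [->|mx]; [left|right; lia]. Qed.

Lemma pidealD n x y : pideal v n x -> pideal v n y -> pideal v n (x + y).
Proof.
move=> nx ny; have [->|x0] := eqVneq x 0; first by rewrite add0r.
have [->|y0] := eqVneq y 0; first by rewrite addr0.
have [->|s0] := eqVneq (x + y) 0; first exact: pideal0.
move/pidealP: nx => /(_ x0) nx; move/pidealP: ny => /(_ y0) ny.
case: v_val => _ /(_ x y x0 y0 s0) + _.
by rewrite ge_min => /orP[/(le_trans nx)|/(le_trans ny)] ?; right.
Qed.

Lemma pidealN n x : pideal v n x -> pideal v n (- x).
Proof. by case=> [->|nx]; [left; rewrite oppr0|right; rewrite valN]. Qed.

Lemma pidealB n x y : pideal v n x -> pideal v n y -> pideal v n (x - y).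
Proof. by move=> nx ny; apply/pidealD/pidealN. Qed.

Lemma pidealM m n x y :
  pideal v m x -> pideal v n y -> pideal v (m + n) (x * y).
Proof.
move=> mx ny; have [->|x0] := eqVneq x 0; first by rewrite mul0r; left.
have [->|y0] := eqVneq y 0; first by rewrite mulr0; left.
move/pidealP: mx => /(_ x0) mx; move/pidealP: ny => /(_ y0) ny.
by right; rewrite valM //; lia.
Qed.

Lemma pidealMW (l m n : int) x y :
  pideal v m x -> pideal v n y -> l <= m + n -> pideal v l (x * y).
Proof. by move=> mx ny lmn; apply: pidealW lmn _; apply: pidealM. Qed.

Lemma pideal_nat (n : nat) : pideal v 0 n%:R.
Proof. by elim: n => [|n IHn]; [left|rewrite -natr1; apply/pidealD/pideal1]. Qed.

Lemma pideal_divl m n x y : y != 0 -> v y = n ->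
  pideal v (n + m) (y * x) -> pideal v m x.
Proof.
move=> y0 vy; have [->|x0] := eqVneq x 0; first by left.
by move/pidealP => /(_ (mulf_neq0 y0 x0)); rewrite valM //; right; lia.
Qed.

Lemma pideal_eq0 x : (forall n, pideal v n x) -> x = 0.
Proof.
move=> px; apply/eqP/negPn/negP => x0.
by have /pidealP := px (v x + 1) => /(_ x0); lia.
Qed.

Lemma val_addl x y : x != 0 -> pideal v (v x + 1) y ->
  x + y != 0 /\ v (x + y) = v x.
Proof.
move=> x0 py.
have s0 : x + y != 0.
  apply/eqP => /addr0_eq yE; move: py; rewrite -yE => /pidealN.
  by rewrite opprK => /(pidealP _ x0); lia.
split=> //; have /(pidealP _ s0) le : pideal v (v x) (x + y).
  by apply: pidealD; [right|apply: pidealW py; lia].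
have [lt|] := ltP (v x) (v (x + y)); last by move=> ?; apply/le_anti/andP.
have /(pidealP _ x0) : pideal v (v x + 1) x; last by lia.
rewrite -{2}(addrK y x); apply: pidealB => //.
by apply/(pidealP _ s0); rewrite -ltzD1 ltrD2r.
Qed.

Lemma unit_pideal x : x != 0 -> pideal v 0 x -> pideal v 0 x^-1 -> v x = 0.
Proof.
by move=> x0 /(pidealP _ x0) px /(pidealP _ (invr_neq0 x0)); rewrite valV //; lia.
Qed.

End Valuation.

(** * Unramified quadratic extensions *)

Section QuadraticExtension.
Context (F : fieldType) (E : fieldExtType F) (E_quadratic : \dim {: E} = 2%N).
Context (conj : {lrmorphism E -> E}) (conj_nontrivial : exists x, conj x <> x).
Implicit Types (x y z : E) (a b : F).

Lemma quadratic_span x : (forall a, x != a%:A) ->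
  forall z, exists a b, z = a%:A + b *: x.
Proof.
move=> xF z.
have x1 : x \notin (1%VS : {vspace E}).
  by apply/negP => /vlineP[a xa]; have := xF a; rewrite xa eqxx.
have dimU : \dim (1 + <[x]>)%VS = 2%N.
  rewrite dimv_disjoint_sum ?dimv1 ?dim_vline.
    by have -> : x != 0 by have := xF 0; rewrite scale0r.
  apply/eqP; rewrite -subv0; apply/subvP => y; rewrite memv_cap => /andP[y1].
  move=> /vlineP[b yb]; rewrite memv0 yb.
  have [->|b0] := eqVneq b 0; first by rewrite scale0r.
  case/negP: x1; rewrite -[x](scalerK b0) -yb.
  exact: memvZ.
have /eqP US : (1 + <[x]> == fullv)%VS.
  by rewrite eqEdim subvf dimU E_quadratic.
have : z \in (1 + <[x]>)%VS by rewrite US memvf.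
case/memv_addP => y /vlineP[a ->] [y' /vlineP[b ->] ->].
by exists a, b.
Qed.

Lemma conj_gen x a b : conj (a%:A + b *: x) = a%:A + b *: conj x.
Proof. by rewrite linearD !linearZ rmorph1. Qed.

Lemma conj_scalar a : conj a%:A = a%:A.
Proof. by rewrite linearZ rmorph1. Qed.

(** An element x moved by [conj] satisfies a quadratic equation over F; its conjugate is the other
    root, so the two add up to the coefficient s. *)
Lemma trace_generator :
  exists x s, [/\ forall a, x != a%:A & conj x = s%:A - x].
Proof.
have [x xN] := conj_nontrivial.
have xF a : x != a%:A by apply: contra_notN xN => /eqP ->; rewrite conj_scalar.
have [t [s x2]] := quadratic_span xF (x * x).
exists x, s; split=> //.
have cx2 : conj (x * x) = t%:A + s *: conj x by rewrite x2 conj_gen.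
rewrite rmorphM /= in cx2.
have : (conj x - x) * (conj x - (s%:A - x)) = 0.
  have -> : (conj x - x) * (conj x - (s%:A - x)) =
      conj x * conj x - x * x - s%:A * (conj x - x) by ring.
  by rewrite cx2 x2 mulr_algl scalerBr; ring.
by move/eqP; rewrite mulf_eq0 !subr_eq0 => /orP[/eqP|/eqP].
Qed.

Lemma conjK : involutive conj.
Proof.
have [x [s [xF cx]]] := trace_generator.
move=> y; have [a [b ->]] := quadratic_span xF y.
by rewrite !conj_gen cx linearB /= conj_scalar cx subKr.
Qed.

Lemma trace_scalar y : exists a, y + conj y = a%:A.
Proof.
have [x [s [xF cx]]] := trace_generator.
have [a [b ->]] := quadratic_span xF y.
exists (a + a + b * s); rewrite conj_gen cx scalerBr !scalerDl -scalerA.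
by ring.
Qed.

End QuadraticExtension.

Section UnramifiedExtension.
Context (F : fieldType) (vF : F -> int) (F_local : local_field vF).
Context (E : fieldExtType F) (E_quadratic : \dim {: E} = 2%N).
Context (vE : E -> int) (vE_val : discrete_valuation vE).
Context (E_unram : unramified vF vE).
Context (conj : {lrmorphism E -> E}) (conj_nontrivial : exists x, conj x <> x).
Implicit Types (x y z : E) (a b : F).

Let vF_val : discrete_valuation vF. Proof. by case: F_local. Qed.

Lemma scalar_eq0 a : (a%:A == 0 :> E) = (a == 0).
Proof. by rewrite scaler_eq0 oner_eq0 orbF. Qed.

Lemma scalar_div a b : (a / b)%:A = a%:A / b%:A :> E.
Proof. by rewrite -!in_algE fmorph_div. Qed.

Lemma pideal_scalar n a : pideal vE n a%:A <-> pideal vF n a.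
Proof.
have [->|a0] := eqVneq a 0; first by rewrite scale0r; split=> _; left.
by rewrite !pidealP ?scalar_eq0 // E_unram.
Qed.

(* The traces t_n of y^n lie in F and t_(n+1) / t_n tends to conj y, so by
   completeness conj y would lie in F. *)
Lemma no_negative_conj y : y != 0 -> conj y = y^-1 -> vE y <= 0.
Proof.
move=> y0 cy; rewrite leNgt; apply/negP => vy.
have tr (n : nat) : exists a, y ^+ n.+1 + y ^- n.+1 = a%:A.
  have [a aE] := trace_scalar E_quadratic conj_nontrivial (y ^+ n.+1).
  by exists a; rewrite -aE rmorphXn /= cy exprVn.
pose t n := projT1 (cid (tr n)).
have tE n : (t n)%:A = y ^+ n.+1 + y ^- n.+1 by rewrite /t; case: cid.
have yn0 n : y ^+ n != 0 by rewrite expf_neq0.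
have tP n : (t n)%:A != 0 :> E /\ vE (t n)%:A = - (vE y * n.+1%:Z).
  rewrite tE addrC -(valX vE_val) // -valV // ; apply: val_addl; rewrite ?invr_neq0 //.
  by right; rewrite valV // valX //; nia.
pose u n := t n.+1 / t n.
have uE n : pideal vE n%:Z ((u n)%:A - y^-1).
  have [t0 vt] := tP n.
  have -> : (u n)%:A - y^-1 = y ^+ n.+1 * ((y - y^-1) / (t n)%:A).
    rewrite /u scalar_div.
    move: t0; rewrite !tE => t0.
    apply: (mulIf t0); rewrite mulrBl mulfVK // -mulrA mulfVK //.
    by rewrite !exprS; field; rewrite y0 yn0.
  apply: (@pidealMW _ _ vE_val _ (vE y * n.+1%:Z) (- vE y + vE y * n.+1%:Z)).
  - by right; rewrite valX.
  - apply: pidealM => //; last by right; rewrite valV // vt; lia.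
    by apply: pidealB => //; right; rewrite ?valV //; lia.
  - by nia.
have [] := F_local => _ /(_ u) Fc _.
case: Fc => [m|l ul].
  exists `|m|%N => i j mi mj; apply/pideal_scalar; rewrite scalerBl.
  have -> : (u i)%:A - (u j)%:A = (u i)%:A - y^-1 - ((u j)%:A - y^-1) :> E by ring.
  by apply: pidealB => //; apply: pidealW (uE _); lia.
have yl : l%:A - y^-1 = 0 :> E.
  apply: (@pideal_eq0 _ vE) => m; have [n nP] := ul m.
  pose i := maxn n `|m|%N.
  have -> : l%:A - y^-1 = ((u i)%:A - y^-1) - (u i - l)%:A :> E.
    by rewrite scalerBl; ring.
  apply: pidealB => //.
    by apply: pidealW (uE _); rewrite /i; lia.
  by apply/pideal_scalar; apply: nP; rewrite /i; lia.
(* The limit l = y^-1 lies in F, hence is fixed by [conj]; so y = y^-1, against [vE y > 0]. *)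
have := conj_scalar conj l; rewrite (subr0_eq yl) fmorphV /= cy invrK => yV.
have : vE y^-1 = vE y by rewrite -yV.
by rewrite valV //; lia.
Qed.

(** [conj] inverts z / conj z, so [no_negative_conj] gives one inequality for every z; the case z =
    conj x is the other one. *)
Lemma val_conj x : x != 0 -> vE (conj x) = vE x.
Proof.
have le z : z != 0 -> vE z <= vE (conj z).
  move=> z0; have cz0 : conj z != 0 by rewrite fmorph_eq0.
  have := @no_negative_conj (z / conj z).
  rewrite mulf_neq0 ?invr_neq0 // rmorphM fmorphV /= conjK // invfM invrK.
  rewrite [conj z / z]mulrC => /(_ isT erefl).
  by rewrite valM ?invr_neq0 // valV //; lia.
move=> x0; apply/le_anti; rewrite le // andbT.
by rewrite -{2}[x](conjK E_quadratic conj_nontrivial) le // fmorph_eq0.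
Qed.

(** The residue field of E is spanned by 1 and x over that of F. If some integral x has a class
    outside the residue field of F, write z = a + bx: a non-integral b would make z / b small, and x
    would be congruent to -a / b. If there is no such x, then 0 serves. *)
Lemma residue_generator : exists x, pideal vE 0 x /\
  forall z, pideal vE 0 z -> exists a b,
    [/\ pideal vF 0 a, pideal vF 0 b & pideal vE 1 (z - (a%:A + b *: x))].
Proof.
have [[x [x0 xF]]|nox] := pselect (exists x, pideal vE 0 x /\
    forall a, pideal vF 0 a -> ~ pideal vE 1 (x - a%:A)); last first.
  exists 0; split; first by left.
  move=> z z0; have [a [a0 za]] : exists a, pideal vF 0 a /\ pideal vE 1 (z - a%:A).
    apply: contrapT => /forallNP za; apply: nox; exists z; split=> // a a0 zP.
    by apply: (za a).
  by exists a, 0; split=> //; [left|rewrite scaler0 addr0].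
exists x; split=> // z z0.
have xna a : x != a%:A.
  apply/eqP => xa; apply: (xF a); first by apply/pideal_scalar; rewrite -xa.
  by rewrite xa subrr; left.
have [a [b zE]] := quadratic_span E_quadratic xna z.
suff [a0 b0] : pideal vF 0 a /\ pideal vF 0 b.
  by exists a, b; split=> //; rewrite -zE subrr; left.
suff b0 : pideal vF 0 b.
  split=> //; apply/pideal_scalar.
  have -> : a%:A = z - b%:A * x by rewrite zE mulr_algl addrK.
  by apply: pidealB => //; apply: (pidealMW vE_val (m := 0) _ x0) => //; apply/pideal_scalar.
have [->|bn0] := eqVneq b 0; first by left.
right; rewrite leNgt; apply/negP => vb.
have bA0 : b%:A != 0 :> E by rewrite scalar_eq0.
have zE' : z = a%:A + b%:A * x by rewrite mulr_algl.
have ba : pideal vE 0 (a / b)%:A.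
  rewrite scalar_div.
  have -> : a%:A / b%:A = z / b%:A - x by rewrite zE'; field.
  apply: pidealB => //; apply: (@pidealMW _ _ vE_val _ 0 (- vF b)) => //; last by lia.
  by right; rewrite valV // E_unram.
apply: (xF (- (a / b))); first by apply: pidealN => //; apply/pideal_scalar.
rewrite scaleNr opprK scalar_div.
have -> : x + a%:A / b%:A = z / b%:A by rewrite zE'; field.
apply: (@pidealMW _ _ vE_val _ 0 (- vF b)) => //; last by lia.
by right; rewrite valV // E_unram.
Qed.

Lemma finite_residue_classes : finite_set (residue_classes vE).
Proof.
have [x [x0 xP]] := residue_generator.
have [_ _ Ffin] := F_local.
(* The classes of a and b determine that of a + bx, so pairs of residue classes of F cover those of
   E. *)
pose h (C : set F * set F) : set E :=
  [set y | exists a b, [/\ C.1 a, C.2 b & pideal vE 1 (y - (a%:A + b *: x))]].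
apply: (@sub_finite_set _ _ (h @` (residue_classes vF `*` residue_classes vF))).
  move=> _ [z z0 <-]; have [a [b [a0 b0 zab]]] := xP z z0.
  exists ([set c | pideal vF 1 (c - a)], [set c | pideal vF 1 (c - b)]).
    by split; [exists a|exists b].
  rewrite /h /=; apply/seteqP; split=> y /=.
    move=> [a' [b' [aa bb yab]]].
    have -> : y - z = (y - (a'%:A + b' *: x)) + (a' - a)%:A + (b' - b)%:A * x
                      - (z - (a%:A + b *: x)).
      by rewrite mulr_algl !scalerBl; ring.
    apply: pidealB => //; apply: pidealD => //; first apply: pidealD => //.
      exact/pideal_scalar.
    by apply: (pidealMW vE_val (m := 1) _ x0) => //; apply/pideal_scalar.
  move=> yz; exists a, b; split; rewrite ?subrr; try by left.
  by have := pidealD vE_val yz zab; rewrite addrA subrK.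
by apply: finite_image; apply: finite_setX.
Qed.

(** [fset_set] sends an infinite set to the empty one, hence the appeal to finiteness. Positivity
    makes [absval] non-zero on E^*. *)
Lemma residue_card_gt0 : (0 < residue_card vE)%N.
Proof.
rewrite /residue_card cardfs_gt0; apply/fset0Pn.
exists [set y | pideal vE 1 (y - 0)]; rewrite in_fset_set ?inE.
  by exists 0 => //; left.
exact: finite_residue_classes.
Qed.

End UnramifiedExtension.

(** * Conductors of quasi-characters *)

Section NoSmallSubgroups.
Context (R : realType).

(* If z != 1, the distance |z^(2^k) - 1| would grow at least like (3/2)^k. *)
Lemma close_powers_eq1 (z : R[i]) :
  (forall k : nat, `|z ^+ (2 ^ k) - 1| < (2^-1)%:C) -> z = 1.
Proof.
move=> zP; apply/eqP/negPn/negP => z1.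
have [r rE] : exists r : R, `|z - 1| = r%:C.
  by rewrite normc_def; eexists.
have r0 : 0 < r by rewrite -ltcR -rE normr_gt0 subr_eq0.
(* A linear lower bound already diverges. With u = z^(2^k) - 1 the next term is u(2 + u), and |2 +
   u| >= 3/2. *)
have grow k : ((1 + k%:R / 2) * r)%:C <= `|z ^+ (2 ^ k) - 1|.
  elim: k => [|k IHk]; first by rewrite mul0r addr0 mul1r expn0 expr1 rE.
  have -> : z ^+ (2 ^ k.+1) - 1 = (z ^+ (2 ^ k) - 1) * (2%:R + (z ^+ (2 ^ k) - 1)).
    by rewrite expnS mulnC exprM; ring.
  rewrite normrM.
  have h : (3 / 2)%:C <= `|2%:R + (z ^+ (2 ^ k) - 1)|.
    rewrite -[z ^+ _ - 1]opprK; apply: le_trans (lerB_dist _ _).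
    rewrite normrN normr_nat lerBrDr -lerBrDl.
    have -> : (2%:R : R[i]) - (3 / 2)%:C = (2^-1)%:C.
      by rewrite -(rmorph_nat (real_complex R)) -rmorphB /=; congr (_%:C); lra.
    exact/ltW/zP.
  apply: (@le_trans _ _ (((1 + k%:R / 2) * r)%:C * (3 / 2)%:C)).
    rewrite -rmorphM lecR -natr1.
    have : 0 <= k%:R :> R by [].
    nra.
  apply: ler_pM => //; rewrite lecR //; last by lra.
  by apply: mulr_ge0; [have : 0 <= k%:R :> R by []; lra|exact: ltW].
have [k kP] : exists k : nat, r^-1 < k%:R.
  by exists (Num.bound r^-1); apply: archi_boundP; rewrite invr_ge0 ltW.
have := le_lt_trans (grow k) (zP k); rewrite ltcR.
have : 1 < k%:R * r by rewrite -ltr_pdivrMr // mul1r.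
nra.
Qed.

Context (K : fieldType) (v : K -> int) (v_val : discrete_valuation v).

Lemma quasi_character1 (A : set K) (chi : K -> R[i]) :
  quasi_character v A chi -> A 1 -> chi 1 = 1.
Proof.
move=> [chi0 chiM _] A1; apply: (mulfI (chi0 1 A1)).
by rewrite -chiM // !mulr1.
Qed.

(** Continuity at 1 puts chi within 1/2 of 1 on A :&: (1 + p^m). For m >= 0 this set is stable under
    squaring, so every chi(x)^(2^k) stays that close to 1 and [close_powers_eq1] applies. Replacing
    m by its absolute value ensures m >= 0. *)
Lemma quasi_character_locally_trivial (A : set K) (chi : K -> R[i]) :
  quasi_character v A chi -> A 1 -> (forall x y, A x -> A y -> A (x * y)) ->
  exists n : nat, forall x, A x -> pideal v n%:Z (x - 1) -> chi x = 1.
Proof.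
move=> chi_char A1 AM; have chi1 := quasi_character1 chi_char A1.
have [_ chiM chiC] := chi_char.
have [|m mP] := chiC 1 A1 (2^-1); first by rewrite invr_gt0.
exists `|m|%N => x Ax xP.
have pw k : [/\ A (x ^+ (2 ^ k)), pideal v `|m|%N%:Z (x ^+ (2 ^ k) - 1)
              & chi (x ^+ (2 ^ k)) = chi x ^+ (2 ^ k)].
  elim: k => [|k [Ak pk ck]]; first by rewrite expn0 !expr1.
  rewrite expnS mulnC !exprM -ck !expr2 -chiM //; split=> //; first exact: AM.
  have -> : x ^+ (2 ^ k) * x ^+ (2 ^ k) - 1 =
    (x ^+ (2 ^ k) - 1) * ((x ^+ (2 ^ k) - 1) + 2%:R) by ring.
  apply: (pidealMW v_val (n := 0) pk) => //; last by lia.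
  by apply: pidealD => //; [apply: pidealW pk; lia|apply: pideal_nat].
apply: close_powers_eq1 => k; have [Ak pk <-] := pw k.
by rewrite -chi1; apply: mP => //; apply: pidealW pk; lia.
Qed.

End NoSmallSubgroups.

Section Conductors.
Context (R : realType) (K : fieldType) (v : K -> int).
Context (v_val : discrete_valuation v) (conj : {rmorphism K -> K}).
Context (val_conj : forall x : K, x != 0 -> v (conj x) = v x).
Context (mu1 mu2 : K -> R[i]).
Context (mu1_char : quasi_character v [set x | x != 0] mu1).
Context (mu2_char : quasi_character v (norm_one conj) mu2).

Lemma norm_one_unit x : norm_one conj x -> x != 0 /\ v x = 0.
Proof.
rewrite /norm_one /= => xx.
have x0 : x != 0 by apply: contra_eq_neq xx => ->; rewrite mul0r eq_sym oner_neq0.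
have : v (x * conj x) = 0 by rewrite xx val1.
by rewrite valM ?fmorph_eq0 // val_conj //; split=> //; lia.
Qed.

(** Local triviality shows that [nat_min] is taken over a non-empty set, and that set is upward
    closed. *)
Lemma conductor1P (m : nat) :
  (forall x, pideal v m%:Z (x - 1) -> integer_units v x -> mu1 x = 1) <->
  (conductor1 v mu1 <= m)%N.
Proof.
have [|mu1c min1] := @nat_minP [set n : nat | forall x,
    pideal v n%:Z (x - 1) -> integer_units v x -> mu1 x = 1].
  have [||n nP] := quasi_character_locally_trivial v_val mu1_char.
  - exact: oner_neq0.
  - by move=> x y /= x0 y0; rewrite mulf_neq0.
  by exists n => x xn [x0 _]; apply: nP.
split=> [/min1 //|le x xm]; apply: mu1c; apply: pidealW xm.
by rewrite lez_nat.
Qed.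

Lemma conductor2P (m : nat) :
  (forall x, norm_one_filtration v conj m x -> mu2 x = 1) <->
  (conductor2 v conj mu2 <= m)%N.
Proof.
have filtS (i j : nat) x : (i <= j)%N ->
    norm_one_filtration v conj j x -> norm_one_filtration v conj i x.
  rewrite /norm_one_filtration; case: (i =P 0%N) => [->|/eqP i0] ij.
    by case: (j == _) => // -[].
  have -> : (j == 0)%N = false by lia.
  by move=> [x1 /= xj]; split=> //=; apply: pidealW xj; lia.
have [|mu2c min2] := @nat_minP [set n : nat | forall x,
    norm_one_filtration v conj n x -> mu2 x = 1].
  have [||n nP] := quasi_character_locally_trivial v_val mu2_char.
  - by rewrite /norm_one /= rmorph1 mulr1.
  - by move=> x y; rewrite /norm_one /= rmorphM mulrACA => -> ->; rewrite mulr1.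
  (* Level 0 is defined without a congruence; the successor guarantees that one is available. *)
  exists n.+1 => x [x1 /= xn]; apply: nP => //; apply: pidealW xn; lia.
by split=> [/min2 //|le x /(filtS _ _ _ le)]; apply: mu2c.
Qed.

End Conductors.

(** * The unitary group *)

Lemma ord3_ind (P : 'I_3 -> Prop) : P 0 -> P 1 -> P 2 -> forall i, P i.
Proof.
move=> P0 P1 P2 [[|[|[|//]]] iP].
- by rewrite (_ : Ordinal iP = 0) //; apply: val_inj.
- by rewrite (_ : Ordinal iP = 1) //; apply: val_inj.
- by rewrite (_ : Ordinal iP = 2) //; apply: val_inj.
Qed.

Lemma sum3 (V : nmodType) (f : 'I_3 -> V) : \sum_i f i = f 0 + f 1 + f 2.
Proof.
rewrite !big_ord_recl big_ord0 addr0 addrA.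
by congr (f _ + f _ + f _); apply: val_inj.
Qed.

Lemma rev_ord3 : (rev_ord (0 : 'I_3) = 2) * (rev_ord (1 : 'I_3) = 1)
  * (rev_ord (2 : 'I_3) = 0).
Proof. by split; first split; apply: val_inj. Qed.

Definition mx3 (K : fieldType) (a00 a01 a02 a10 a11 a12 a20 a21 a22 : K) :
  'M[K]_3 := \matrix_(i < 3, j < 3) nth 0 (nth [::]
    [:: [:: a00; a01; a02]; [:: a10; a11; a12]; [:: a20; a21; a22]] i) j.

Section UnitaryGroup.
Context (K : fieldType) (conj : {rmorphism K -> K}).
Implicit Types (g h b : U3 conj) (A B : 'M[K]_3) (i j : 'I_3).

Lemma mulmx3 A B i j :
  (A *m B) i j = A i 0 * B 0 j + A i 1 * B 1 j + A i 2 * B 2 j.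
Proof. by rewrite mxE sum3. Qed.

Lemma J3_mull A i j : (J3 K *m A) i j = A (rev_ord i) j.
Proof.
rewrite mxE (bigD1 (rev_ord i)) //= mxE eqxx mul1r big1 ?addr0 // => k /negPf kN.
by rewrite mxE kN mul0r.
Qed.

Lemma J3_mulr A i j : (A *m J3 K) i j = A i (rev_ord j).
Proof.
rewrite mxE (bigD1 (rev_ord j)) //= mxE rev_ordK eqxx mulr1 big1 ?addr0 // => k kN.
by rewrite mxE -(inj_eq rev_ord_inj) rev_ordK eq_sym (negPf kN) mulr0.
Qed.

Lemma J3K : J3 K *m J3 K = 1%:M.
Proof. by apply/matrixP => i j; rewrite J3_mull !mxE rev_ordK eq_sym. Qed.

(** Invertibility follows from the equations because J is its own inverse. *)
Lemma unitary3P A : unitary3 conj A <-> forall i j,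
  conj (A 0 i) * A 2 j + conj (A 1 i) * A 1 j + conj (A 2 i) * A 0 j
  = (j == rev_ord i)%:R.
Proof.
have eqE i j : ((map_mx conj A)^T *m J3 K *m A) i j =
    conj (A 0 i) * A 2 j + conj (A 1 i) * A 1 j + conj (A 2 i) * A 0 j.
  by rewrite mulmx3 !J3_mulr !rev_ord3 !mxE; ring.
rewrite /unitary3; split=> [/andP[_ /eqP gJ] i j|gJ].
  by rewrite -eqE gJ mxE.
have eqJ : (map_mx conj A)^T *m J3 K *m A = J3 K.
  by apply/matrixP => i j; rewrite eqE gJ mxE.
rewrite eqJ eqxx andbT.
suff : A^T \in unitmx by rewrite unitmx_tr.
have := congr1 (fun B => J3 K *m B) eqJ; rewrite J3K mulmxA => /mulmx1_unit[_].
by rewrite unitmx_tr.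
Qed.

Lemma U3M g h : U3_mx (g * h)%g = g *m h. Proof. by []. Qed.

Lemma U3_1 : U3_mx (1%g : U3 conj) = 1%:M. Proof. by []. Qed.

Lemma U3_inj g h : g = h :> 'M[K]_3 -> g = h. Proof. exact: val_inj. Qed.

Lemma U3ME g h i j : U3_mx (g * h)%g i j = g i 0 * h 0 j + g i 1 * h 1 j + g i 2 * h 2 j.
Proof. by rewrite U3M mulmx3. Qed.

Lemma U3VE g i j : U3_mx (g^-1)%g i j = conj (g (rev_ord j) (rev_ord i)).
Proof.
have -> : U3_mx (g^-1)%g = J3 K *m (map_mx conj g)^T *m J3 K.
  have /andP[gu /eqP gJ] := valP g.
  have gJ1 : J3 K *m (map_mx conj g)^T *m J3 K *m g = 1%:M.
    by rewrite -!mulmxA [_ *m (J3 K *m _)]mulmxA gJ J3K.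
  by rewrite -[LHS]mul1mx -gJ1 -mulmxA -U3M mulgV U3_1 mulmx1.
by rewrite J3_mulr J3_mull !mxE.
Qed.

(** Entry (i, j) of g g^-1 = 1. For i = 2 and j = 0 it says that the bottom row is isotropic. *)
Lemma U3_rows g i j : g i 0 * conj (g (rev_ord j) 2) + g i 1 * conj (g (rev_ord j) 1)
  + g i 2 * conj (g (rev_ord j) 0) = (i == j)%:R.
Proof.
have := U3ME g g^-1%g i j.
by rewrite mulgV U3_1 !U3VE !rev_ord3 mxE.
Qed.

Definition mkU3 A (AP : unitary3 conj A) : U3 conj := Sub A AP.

Lemma mkU3E A (AP : unitary3 conj A) : mkU3 AP = A :> 'M[K]_3. Proof. by []. Qed.

Lemma borelP b : borel conj b <-> [/\ b 1 0 = 0, b 2 0 = 0 & b 2 1 = 0].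
Proof.
split=> [bB|[b10 b20 b21]]; first by split; apply: bB.
by apply: ord3_ind; apply: ord3_ind => // _.
Qed.

Lemma borel_diag b : borel conj b ->
  b 0 0 * conj (b 2 2) = 1 /\ b 1 1 * conj (b 1 1) = 1.
Proof.
move=> /borelP[b10 b20 b21].
have := U3_rows b 0 0; have := U3_rows b 1 1.
by rewrite !rev_ord3 b10 b20 b21 rmorph0 !mulr0 ?mul0r !addr0 add0r.
Qed.

(** Row 1 is orthogonal to the bottom row (0, 0, c), which forces its first entry to vanish since c
    is non-zero. *)
Lemma borel_of_row b : b 2 0 = 0 -> b 2 1 = 0 -> borel conj b.
Proof.
move=> b20 b21; apply/borelP; split=> //.
have := U3_rows b 0 0; have := U3_rows b 1 0.
rewrite !rev_ord3 b20 b21 rmorph0 !mulr0 !addr0 => h1 h0.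
move: h1 => /eqP; rewrite mulf_eq0 => /orP[/eqP //|/eqP c0].
by move: h0; rewrite c0 mulr0 => /esym/eqP; rewrite oner_eq0.
Qed.

Lemma borelM b h : borel conj b -> borel conj h -> borel conj (b * h)%g.
Proof.
move=> /borelP[b10 b20 b21] /borelP[h10 h20 h21].
by apply/borelP; rewrite !U3ME b10 b20 b21 h10 h20 h21 !(mul0r, mulr0, addr0).
Qed.

Lemma borelV b : borel conj b -> borel conj b^-1%g.
Proof.
move=> /borelP[b10 b20 b21].
by apply/borelP; rewrite !U3VE !rev_ord3 b10 b20 b21 rmorph0.
Qed.

Lemma borel_mul_row b g j : borel conj b -> U3_mx (b * g)%g 2 j = b 2 2 * g 2 j.
Proof. by move=> /borelP[_ b20 b21]; rewrite U3ME b20 b21 !mul0r !add0r. Qed.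

Lemma borel_diagM b h : borel conj b -> borel conj h ->
  U3_mx (b * h)%g 0 0 = b 0 0 * h 0 0 /\ U3_mx (b * h)%g 1 1 = b 1 1 * h 1 1.
Proof.
move=> /borelP[b10 b20 b21] /borelP[h10 h20 h21].
by rewrite !U3ME b10 h10 h20 h21 !(mul0r, mulr0, addr0, add0r).
Qed.

(** Injectivity of the map from B \ G to isotropic lines: g h^-1 has bottom row (0, 0, c). *)
Lemma borel_same_row g h c : (forall j, g 2 j = c * h 2 j) ->
  exists2 b, borel conj b & g = (b * h)%g.
Proof.
move=> gh; exists (g * h^-1)%g; last by rewrite mulgVK.
have row j : U3_mx (g * h^-1)%g 2 j = c * (2 == j)%:R.
  by rewrite U3ME !gh -!mulrA -!mulrDr -U3ME mulgV U3_1 mxE.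
by apply: borel_of_row; rewrite row mulr0.
Qed.

End UnitaryGroup.

(** * Explicit elements of G *)

Section ExplicitElements.
Context (K : fieldType) (conj : {rmorphism K -> K}) (conjK : involutive conj).

(** Representative of the isotropic line through (x, y, 1); gamma_i is the case x = -w^(2i)/2, y =
    -w^i. *)
Lemma lower_unitary x y : x + conj x + y * conj y = 0 ->
  unitary3 conj (mx3 1 0 0 (- conj y) 1 0 x y 1).
Proof.
move=> xy; apply/unitary3P.
apply: ord3_ind; apply: ord3_ind; rewrite !mxE -val_eqE /= ?rmorphN ?conjK
  ?rmorph1 ?rmorph0; try by ring.
by rewrite -xy; ring.
Qed.

Lemma torus_unitary (a : K) : a != 0 ->
  unitary3 conj (mx3 a 0 0 0 1 0 0 0 (conj a)^-1).
Proof.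
move=> a0; have ca0 : conj a != 0 by rewrite fmorph_eq0.
apply/unitary3P.
by apply: ord3_ind; apply: ord3_ind; rewrite !mxE -val_eqE /= ?fmorphV ?conjK
  ?rmorph1 ?rmorph0 /=; field; rewrite ?a0 ?ca0.
Qed.

(** For t = w^n this lies in K_n and exchanges the outer coordinates of a row, up to powers of w. *)
Lemma weyl_unitary (t : K) : t != 0 -> conj t = t ->
  unitary3 conj (mx3 0 0 t^-1 0 1 0 t 0 0).
Proof.
move=> t0 ct; apply/unitary3P.
by apply: ord3_ind; apply: ord3_ind; rewrite !mxE -val_eqE /= ?fmorphV ?ct
  ?rmorph1 ?rmorph0 /=; field.
Qed.

Section Stabilizer.
Context (t : K) (t0 : t != 0) (ct : conj t = t) (K2 : 2%:R != 0 :> K).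

(* With t = w ^ i, the conjugate of diag(a, 1, conj a ^-1) by gamma_i^-1. *)
Lemma stab_torus_unitary (a : K) : a != 0 ->
  unitary3 conj (mx3 a 0 0 (t * (1 - a)) 1 0
    (- (t * t / 2%:R) * (a - 1 + ((conj a)^-1 - 1)))
    (t * (1 - (conj a)^-1)) (conj a)^-1).
Proof.
move=> a0; have ca0 : conj a != 0 by rewrite fmorph_eq0.
apply/unitary3P.
by apply: ord3_ind; apply: ord3_ind; rewrite !mxE -val_eqE /=
  ?(rmorphM, rmorphN, rmorphB, rmorphD) /= ?fmorphV ?conjK ?ct
  ?rmorph1 ?rmorph0 /= ?rmorph_nat; field; rewrite ?a0 ?ca0 ?K2.
Qed.

Context (d : K) (d1 : norm_one conj d).

Let d0 : d != 0.
Proof. by apply: contra_eq_neq d1 => ->; rewrite mul0r eq_sym oner_neq0. Qed.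

Let cd : conj d = d^-1.
Proof. by apply: (mulfI d0); rewrite d1 divff. Qed.

(* The unipotent part is chosen so that gamma_i^-1 conjugates this element, with
   t = w ^ i, to the element of K_n in [stab_middle_unitary]. *)
Lemma stab_borel_unitary :
  unitary3 conj (mx3 1 ((d - 1) / t) ((d - 1) / (t * t)) 0 d ((d - 1) / t) 0 0 1).
Proof.
apply/unitary3P.
by apply: ord3_ind; apply: ord3_ind; rewrite !mxE -val_eqE /=
  ?(rmorphM, rmorphB, fmorphV) /= ?rmorphM /= ?cd ?ct ?rmorph1 ?rmorph0 /=;
  field; rewrite ?d0 ?t0.
Qed.

(** Conjugating diag(1, d, 1) itself would leave d in the middle, where K_n asks for 1 + p^n; the
    unipotent part turns it into 1. What is left is the corner (d - 1) / t^2, in p^(-n) as soon as d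
    is in 1 + p^(2i-n). *)
Lemma stab_middle_unitary :
  unitary3 conj (mx3 ((d + 1) / 2%:R) 0 ((d - 1) / (t * t)) 0 1 0
    (t * t * (d - 1) / 4%:R) 0 ((d + 1) / 2%:R)).
Proof.
have K4 : 4%:R != 0 :> K by rewrite -[4%N]/(2 * 2)%N natrM mulf_neq0.
apply/unitary3P.
by apply: ord3_ind; apply: ord3_ind; rewrite !mxE -val_eqE /=
  ?(rmorphM, rmorphB, rmorphD, fmorphV) /= ?rmorphM /= ?rmorphB ?rmorphD /=
  ?cd ?ct ?rmorph1 ?rmorph0 /= ?rmorph_nat; field; rewrite ?d0 ?t0 ?K2 ?K4.
Qed.

End Stabilizer.
End ExplicitElements.

(** * Double cosets of the Borel subgroup and K_n *)

Section DoubleCosets.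
Context (K : fieldType) (v : K -> int) (v_val : discrete_valuation v).
Context (conj : {rmorphism K -> K}).
Context (val_conj : forall x : K, x != 0 -> v (conj x) = v x).
Implicit Types (g h b k : U3 conj) (x y z t : K) (i j m : int) (n : nat).

Let pM := pidealM v_val.
Let pMW := pidealMW v_val.
Let pD := pidealD v_val.
Let pB := pidealB v_val.
Let pN := pidealN v_val.

Lemma pideal_conj m x : pideal v m x -> pideal v m (conj x).
Proof.
have [->|x0] := eqVneq x 0; first by rewrite rmorph0.
by rewrite !pidealP ?fmorph_eq0 // val_conj.
Qed.

Lemma Kgroup_one n : Kgroup v conj n 1%g.
Proof.
have p0 m : pideal v m 0 by left.
have p1 : pideal v 0 1 by apply: pideal1.
by rewrite /Kgroup /= U3_1 !mxE /= subrr; split; split.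
Qed.

Lemma Kgroup_mul n g h :
  Kgroup v conj n g -> Kgroup v conj n h -> Kgroup v conj n (g * h)%g.
Proof.
have p11 x : pideal v n%:Z (x - 1) -> pideal v 0 x.
  by move=> xn; rewrite -(subrK 1 x); apply: pD; [apply: pidealW xn|apply: pideal1].
move=> [[g00 g01 g02] [g10 g11 g12] [g20 g21 g22]].
move=> [[h00 h01 h02] [h10 h11 h12] [h20 h21 h22]].
have g11' := p11 _ g11; have h11' := p11 _ h11.
rewrite /Kgroup /= !U3ME; split; split; try by
  (apply: pD; [apply: pD|];
  first [apply: (pMW g00)|apply: (pMW g10)|apply: (pMW g20)
        |apply: (pMW g01)|apply: (pMW g11')|apply: (pMW g21)
        |apply: (pMW g02)|apply: (pMW g12)|apply: (pMW g22)];
  first [eassumption | idtac]; lia).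
(* Only the middle entry remains, where the congruence to 1 modulo p^n has to be kept. *)
set a := (X in _ + X * _ + _); set c := (X in _ + _ * X + _).
have -> : g 1 0 * h 0 1 + a * c + g 1 2 * h 2 1 - 1 =
  g 1 0 * h 0 1 + ((a - 1) * c + (c - 1)) + g 1 2 * h 2 1 by ring.
apply: pD; last by apply: (pMW g12 h21); lia.
apply: pD; first by apply: (pMW g10 h01); lia.
by apply: pD => //; apply: (pMW g11 h11'); lia.
Qed.

(** Inversion conjugates the entries and reflects them in the antidiagonal, under which the pattern
    of ideals of K_n is symmetric. *)
Lemma Kgroup_inv n g : Kgroup v conj n g -> Kgroup v conj n g^-1%g.
Proof.
move=> [[g00 g01 g02] [g10 g11 g12] [g20 g21 g22]].
rewrite /Kgroup /= !U3VE !rev_ord3; split; split; try exact: pideal_conj.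
by rewrite -(rmorph1 conj) -rmorphB; apply: pideal_conj.
Qed.

Lemma Kgroup_open n g : exists m, forall h,
  (forall i j : 'I_3, pideal v m (h i j - g i j)) -> Kgroup v conj n (g^-1 * h)%g.
Proof.
have [l lP] : exists l : int, forall i j : 'I_3, pideal v l (U3_mx g^-1%g i j).
  (* A common lower bound for the valuations of the entries of g^-1; junk values [v 0] only enlarge
     the sum. Precision n - l then puts g^-1 (h - g) in p^n. *)
  exists (- \sum_i \sum_j `|v (U3_mx g^-1%g i j)|) => i j; right.
  rewrite lerNl; apply: le_trans (_ : `|v (U3_mx g^-1%g i j)| <= _).
    by rewrite ler_normr lexx orbT.
  rewrite (bigD1 i) //= (bigD1 j) //= -addrA lerDl addr_ge0 ?sumr_ge0 // => ? _.
  by apply: sumr_ge0.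
exists (n%:Z - l) => h hg.
have close (i j : 'I_3) : pideal v n%:Z (U3_mx (g^-1 * h)%g i j - (i == j)%:R).
  have -> : (i == j)%:R = U3_mx (g^-1 * g)%g i j by rewrite mulVg U3_1 mxE.
  rewrite !U3ME.
  set a := (X in X * _ + _ + _ - _); set c := (X in _ + X * _ + _ - _).
  set e := (X in _ + X * h 2 j - _).
  have -> : a * h 0 j + c * h 1 j + e * h 2 j
      - (a * g 0 j + c * g 1 j + e * g 2 j) =
    a * (h 0 j - g 0 j) + c * (h 1 j - g 1 j) + e * (h 2 j - g 2 j) by ring.
  by apply: pD; [apply: pD|]; apply: (pMW (lP _ _) (hg _ _)); lia.
have close0 (i j : 'I_3) : i != j -> pideal v n%:Z (U3_mx (g^-1 * h)%g i j).
  by move=> /negPf ij; have := close i j; rewrite ij subr0.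
have close1 (i : 'I_3) : pideal v 0 (U3_mx (g^-1 * h)%g i i).
  have := close i i; rewrite eqxx => ii.
  by rewrite -[X in pideal _ _ X](subrK 1); apply: pD;
    [apply: pidealW ii; lia|apply: pideal1].
split; split; try exact: close1; try exact: close0; try exact: (close 1 1);
  by apply: (pidealW _ (close0 _ _ _)) => //; lia.
Qed.

Context (conjK : involutive conj).
Context (K2 : 2%:R != 0 :> K) (v2 : v 2%:R = 0).
Context (w : K) (w0 : w != 0) (vw : v w = 1) (cw : conj w = w).

Lemma val_wX i : w ^ i != 0 /\ v (w ^ i) = i.
Proof. by rewrite expfz_neq0 // valXz // vw mul1r. Qed.

Lemma conj_wX i : conj (w ^ i) = w ^ i. Proof. by rewrite fmorphXz cw. Qed.

Lemma wX_double i : w ^ (2 * i) = w ^ i * w ^ i.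
Proof. by rewrite -expfzDr // -mulr2n mulr_natl. Qed.

Lemma pideal_wX i : pideal v i (w ^ i).
Proof. by right; rewrite (val_wX i).2. Qed.

Lemma pideal_half m x : pideal v m x -> pideal v m (x / 2%:R).
Proof.
move=> mx; rewrite -[m]addr0; apply: pM => //.
by right; rewrite valV // v2.
Qed.

Context (n : nat).

Notation gam i := (gamma conj w i).
Notation Kn := (Kgroup v conj n).

Lemma gammaE i : U3_mx (gam i) =
  mx3 1 0 0 (w ^ i) 1 0 (- (w ^ i * w ^ i / 2%:R)) (- w ^ i) 1.
Proof. by rewrite val_gamma // /gamma_mx wX_double. Qed.

Lemma pideal_wX_sqr i : n%:Z <= 2 * i -> pideal v n%:Z (w ^ i * w ^ i / 2%:R).
Proof. by move=> ni; apply: pideal_half; apply: (pMW (pideal_wX i) (pideal_wX i)); lia. Qed.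

(** * Intersections of B gamma_i with gamma_j K_n *)

Lemma coset_corner_integral i j b k :
  n%:Z <= 2 * i -> n%:Z <= 2 * j -> borel conj b -> Kn k ->
  (b * gam i)%g = (gam j * k)%g -> pideal v 0 (b 2 2).
Proof.
move=> ni nj bB [[_ _ k02] [_ _ k12] [_ _ k22]] bk.
have := borel_mul_row (gam i) 2 bB; rewrite bk U3ME !gammaE !mxE /= mulr1 => <-.
apply: pD; last by rewrite mul1r.
apply: pD; first by apply: (pMW (pN (pideal_wX_sqr nj)) k02); lia.
by apply: (pMW (pN (pideal_wX j)) k12); lia.
Qed.

Lemma borel_corner b : borel conj b ->
  b 2 2 != 0 /\ conj (b 0 0) = (b 2 2)^-1.
Proof.
move=> bB; have [b1 _] := borel_diag bB.
have b22 : b 2 2 != 0.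
  apply: contra_eq_neq b1 => ->.
  by rewrite rmorph0 mulr0 eq_sym oner_neq0.
split=> //; apply: (mulIf b22); rewrite mulVf //.
by rewrite -[b 2 2 in LHS]conjK -rmorphM b1 rmorph1.
Qed.

(** The integrality lemma also applies to b^-1 and k^-1 with i and j exchanged, so b_22 is a unit.
    Comparing the entries (2, 1) then relates the middle coordinates modulo p^n. *)
Lemma coset_corner i j b k :
  n%:Z <= 2 * i -> n%:Z <= 2 * j -> borel conj b -> Kn k ->
  (b * gam i)%g = (gam j * k)%g ->
  v (b 2 2) = 0 /\ pideal v n%:Z (w ^ j - b 2 2 * w ^ i).
Proof.
move=> ni nj bB kK bk; have [b22 cb00] := borel_corner bB.
have bk' : (b^-1 * gam j)%g = (gam i * k^-1)%g.
  by apply: (mulgI b); rewrite mulgA mulgV mul1g mulgA bk mulgK.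
have bi := coset_corner_integral ni nj bB kK bk.
have bVi := coset_corner_integral nj ni (borelV bB) (Kgroup_inv kK) bk'.
have vb : v (b 2 2) = 0.
  by apply: (unit_pideal v_val) => //; rewrite -cb00; move: bVi; rewrite U3VE !rev_ord3.
split=> //.
move: kK => [[_ k01 _] [_ k11 _] [_ k21 _]].
have := borel_mul_row (gam i) 1 bB; rewrite bk U3ME !gammaE !mxE /= mulrN => bE.
have -> : w ^ j - b 2 2 * w ^ i =
    - (w ^ j * w ^ j / 2%:R) * k 0 1 + (- w ^ j * (k 1 1 - 1) + k 2 1).
  by rewrite -bE; ring.
apply: pD; first by apply: (pMW (pN (pideal_wX_sqr nj)) k01); lia.
by apply: pD => //; apply: (pMW (pN (pideal_wX j)) k11); lia.
Qed.

(** If i and j differed, w^j - b_22 w^i would have valuation min(i, j), which is less than n because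
    both are at most n. *)
Lemma coset_disjoint i j b k :
  n%:Z <= 2 * i -> i <= n%:Z -> n%:Z <= 2 * j -> j <= n%:Z ->
  borel conj b -> Kn k -> (b * gam i)%g = (gam j * k)%g -> i = j.
Proof.
move=> ni iN nj jN bB kK bk.
have [vb wij] := coset_corner ni nj bB kK bk.
have [b22 _] := borel_corner bB.
have [wi0 vwi] := val_wX i; have [wj0 vwj] := val_wX j.
have bw0 : b 2 2 * w ^ i != 0 by rewrite mulf_neq0.
have vbw : v (b 2 2 * w ^ i) = i by rewrite valM // vb vwi add0r.
have [lt|lt|//] := ltgtP i j.
  have [||s0 vs] := @val_addl _ _ v_val (b 2 2 * w ^ i) (- w ^ j) => //.
    by right; rewrite valN // vwj vbw; lia.
  by move: wij => /(pidealN v_val); rewrite opprB => /(pidealP _ _ s0); lia.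
have [||s0 vs] := @val_addl _ _ v_val (w ^ j) (- (b 2 2 * w ^ i)) => //.
  by right; rewrite valN // vwj vbw; lia.
by move: wij => /(pidealP _ _ s0); lia.
Qed.

(** For b_00, divide w^i (1 - b_22) in p^n by w^i. For b_11, the entries (1, 2) eliminate the
    unipotent entry b_12; the term w^(2i) k_02 with k_02 in p^(-n) yields the level 2i - n. *)
Lemma coset_stabilizer i b k :
  n%:Z <= 2 * i -> i <= n%:Z -> borel conj b -> Kn k ->
  (b * gam i)%g = (gam i * k)%g ->
  [/\ v (b 0 0) = 0, pideal v (n%:Z - i) (b 0 0 - 1)
    & pideal v (2 * i - n%:Z) (b 1 1 - 1)].
Proof.
move=> ni iN bB kK bk.
have [vb wb] := coset_corner ni ni bB kK bk.
have [b22 cb00] := borel_corner bB.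
have [wi0 vwi] := val_wX i.
have b00 : b 0 0 != 0 by rewrite -(fmorph_eq0 conj) cb00 invr_eq0.
have v00 : v (b 0 0) = 0 by rewrite -val_conj // cb00 valV // vb.
split=> //.
  have : pideal v (n%:Z - i) (1 - b 2 2).
    apply: (pideal_divl v_val wi0 vwi); rewrite mulrBr mulr1 [_ * b 2 2]mulrC.
    by apply: pidealW wb; lia.
  move=> /(pMW (l := n%:Z - i) (m := 0) (or_intror _ : pideal v 0 (b 2 2)^-1)).
  rewrite valV // vb oppr0 lexx => /(_ isT ltac:(lia)).
  by rewrite mulrBr mulr1 mulVf // -cb00 => /pideal_conj; rewrite rmorphB rmorph1 conjK.
move: kK => [[_ k01 k02] [_ k11 k12] _].
have := congr1 (fun g => U3_mx g 1 2) bk.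
have := congr1 (fun g => U3_mx g 1 1) bk.
have /borelP[b10 _ _] := bB.
rewrite !U3ME !gammaE !mxE /= b10 !(mul0r, mulr0, mulr1, mul1r, add0r, addr0).
move=> E1 E2.
have -> : b 1 1 - 1 = w ^ i * k 0 1 + (k 1 1 - 1) + (w ^ i * k 0 2 + k 1 2) * w ^ i.
  rewrite -E2; have -> : b 1 1 = w ^ i * k 0 1 + k 1 1 + b 1 2 * w ^ i.
    by rewrite -E1; ring.
  by ring.
apply: pD; first apply: pD.
- by apply: (pMW (pideal_wX i) k01); lia.
- by apply: pidealW k11; lia.
have e : pideal v (i - n%:Z) (w ^ i * k 0 2 + k 1 2).
  by apply: pD; [apply: (pMW (pideal_wX i) k02)|apply: pidealW k12]; lia.
by apply: (pMW e (pideal_wX i)); lia.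
Qed.

(** With [stab_middle], a converse to [coset_stabilizer], one torus coordinate at a time: each
    admissible value is attained. *)
Lemma stab_torus i (a : K) :
  n%:Z <= 2 * i -> i <= n%:Z -> a != 0 -> v a = 0 -> pideal v (n%:Z - i) (a - 1) ->
  exists b k, [/\ borel conj b, Kn k, (b * gam i)%g = (gam i * k)%g,
    b 0 0 = a & b 1 1 = 1].
Proof.
move=> ni iN a0 va pa; have [wi0 vwi] := val_wX i.
have ca0 : conj a != 0 by rewrite fmorph_eq0.
exists (mkU3 (torus_unitary conjK a0)).
exists (mkU3 (stab_torus_unitary conjK (conj_wX i) K2 a0)).
have pca : pideal v (n%:Z - i) ((conj a)^-1 - 1).
  have -> : (conj a)^-1 - 1 = - ((conj a)^-1 * conj (a - 1)).
    by rewrite rmorphB rmorph1; field.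
  apply: pN; apply: (pMW (m := 0) _ (pideal_conj pa)); last by lia.
  by right; rewrite valV // val_conj // va.
have p0 m : pideal v m 0 by left.
have pi : pideal v 0 a by right; rewrite va.
have pic : pideal v 0 (conj a)^-1 by right; rewrite valV // val_conj // va.
split; rewrite ?mkU3E ?mxE //=.
- by apply/borelP; rewrite mkU3E !mxE.
- rewrite /Kgroup /= !mkU3E !mxE /= subrr; split; split=> //.
  + rewrite -opprB mulrN; apply: pN; apply: (pMW (pideal_wX i) pa); lia.
  + rewrite mulNr; apply: pN; apply: (pMW (pideal_wX_sqr ni) (n := 0)); last by lia.
    by apply: pD; [apply: pidealW pa|apply: pidealW pca]; lia.
  + rewrite -opprB mulrN; apply: pN; apply: (pMW (pideal_wX i) pca); lia.
- apply: U3_inj; rewrite !U3M gammaE !mkU3E; apply/matrixP.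
  by apply: ord3_ind; apply: ord3_ind; rewrite !mulmx3 !mxE /=; field; rewrite ?K2 ?ca0 ?a0.
Qed.

Lemma stab_middle i (d : K) :
  n%:Z <= 2 * i -> i <= n%:Z -> norm_one conj d -> pideal v (2 * i - n%:Z) (d - 1) ->
  exists b k, [/\ borel conj b, Kn k, (b * gam i)%g = (gam i * k)%g,
    b 0 0 = 1 & b 1 1 = d].
Proof.
move=> ni iN d1 pd; have [wi0 vwi] := val_wX i.
have ct := conj_wX i.
exists (mkU3 (stab_borel_unitary wi0 ct d1)).
exists (mkU3 (stab_middle_unitary wi0 ct K2 d1)).
have p0 m : pideal v m 0 by left.
have p1 : pideal v 0 1 by apply: pideal1.
have K4 : 4%:R != 0 :> K by rewrite -[4%N]/(2 * 2)%N natrM mulf_neq0.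
have pd0 : pideal v 0 (d - 1) by apply: pidealW pd; lia.
have ph : pideal v 0 ((d + 1) / 2%:R).
  apply: pideal_half; have -> : d + 1 = (d - 1) + 2%:R by ring.
  by apply: pD => //; apply: pideal_nat.
split; rewrite ?mkU3E ?mxE //=.
- by apply/borelP; rewrite mkU3E !mxE.
- rewrite /Kgroup /= !mkU3E !mxE /= subrr; split; split=> //.
  + apply: (pMW pd (n := - (2 * i))); last by lia.
    by right; rewrite valV ?mulf_neq0 // valM // vwi; lia.
  + have -> : w ^ i * w ^ i * (d - 1) / 4%:R = w ^ i * w ^ i / 2%:R * ((d - 1) / 2%:R).
      by field; rewrite ?K2 ?K4.
    by apply: (pMW (pideal_wX_sqr ni) (pideal_half pd0)); lia.
- apply: U3_inj; rewrite !U3M gammaE !mkU3E; apply/matrixP.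
  by apply: ord3_ind; apply: ord3_ind; rewrite !mulmx3 !mxE /=; field; rewrite ?K2 ?K4 ?wi0.
Qed.

(** * Covering of G by the double cosets *)

Definition covered g := exists i b k, [/\ n%:Z <= 2 * i, i <= n%:Z,
  borel conj b, Kn k & g = (b * gam i * k)%g].

Lemma covered_borel_mul_Kgroup b g k :
  borel conj b -> Kn k -> covered g -> covered (b * g * k)%g.
Proof.
move=> bB kK [i [b' [k' [ni iN bB' kK' ->]]]].
exists i, (b * b')%g, (k' * k)%g; split=> //; first exact: borelM.
  exact: Kgroup_mul.
by rewrite !mulgA.
Qed.

Lemma covered_same_row g h k c : Kn k -> covered h ->
  (forall j : 'I_3, U3_mx (g * k)%g 2 j = c * h 2 j) -> covered g.
Proof.
move=> kK hC /borel_same_row[b bB gk].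
have -> : g = (b * h * k^-1)%g by rewrite -gk mulgK.
exact: covered_borel_mul_Kgroup (Kgroup_inv kK) hC.
Qed.

Lemma covered_lower x y (xy : x + conj x + y * conj y = 0) :
  pideal v n%:Z x -> covered (mkU3 (lower_unitary conjK xy)).
Proof.
move=> px.
have p0 m : pideal v m 0 by left.
have p1 : pideal v 0 1 by apply: pideal1.
have lowerK x' y' (xy' : x' + conj x' + y' * conj y' = 0) :
    pideal v n%:Z x' -> pideal v n%:Z y' -> Kn (mkU3 (lower_unitary conjK xy')).
  move=> px' py'; rewrite /Kgroup /= !mkU3E !mxE /= subrr; split; split=> //.
  exact/pN/pideal_conj.
(* If y is in p^n, both the element and gamma_n belong to K_n, so the index is n. Otherwise it is
   v(y), and isotropy gives n <= 2 v(y). *)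
have [py|npy] := pselect (pideal v n%:Z y).
  exists n%:Z, 1%g, ((gam n)^-1 * mkU3 (lower_unitary conjK xy))%g.
  split; [by lia|by []| | |by rewrite mul1g mulgA mulgV mul1g].
    by apply/borelP; rewrite !U3_1 !mxE.
  apply: Kgroup_mul; last exact: lowerK.
  apply: Kgroup_inv; rewrite /Kgroup /= !gammaE !mxE /= subrr.
  have pw := pideal_wX n%:Z.
  split; split=> //; try exact: pN.
  by apply: pN; apply: pideal_wX_sqr; lia.
have y0 : y != 0 by apply/eqP => y0; apply: npy; rewrite y0.
have cy0 : conj y != 0 by rewrite fmorph_eq0.
have vy : v y < n%:Z by rewrite ltNge; apply/negP => ?; apply: npy; right.
have ni : n%:Z <= 2 * v y.
  have yyE : y * conj y = - (x + conj x) by apply/eqP; rewrite -addr_eq0 addrC xy.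
  have : pideal v n%:Z (y * conj y).
    by rewrite yyE; apply: pN; apply: pD => //; apply: pideal_conj.
  by move/(pidealP _ _ (mulf_neq0 y0 cy0)); rewrite valM // val_conj //; lia.
set i := v y in vy ni; have [wi0 vwi] := val_wX i.
(* Chosen so that diag(a, 1, conj a ^-1), followed by scaling the row by conj a, turns (x, y, 1)
   into (x a conj a, -w^i, 1). *)
have [a aE] : exists a, a = - w ^ i / conj y by eexists.
have ca : conj a = - w ^ i / y by rewrite aE rmorphM rmorphN fmorphV /= conjK conj_wX.
have a0 : a != 0 by rewrite aE mulf_neq0 ?oppr_eq0 ?invr_eq0.
have va : v a = 0.
  by rewrite aE valM ?oppr_eq0 ?invr_eq0 // valN // valV // val_conj // vwi subrr.
(* Corrects the first coordinate to that of gamma_i. Both rows are isotropic with the same middle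
   coordinate, so s has trace 0 and the lower unipotent element with bottom row (s, 0, 1) is
   unitary. *)
pose s := - (w ^ i * w ^ i / 2%:R) - x * (a * conj a).
have ps : pideal v n%:Z s.
  apply: pB; first exact/pN/pideal_wX_sqr.
  apply: (pMW px (n := 0)); last by lia.
  by right; rewrite valM ?fmorph_eq0 // val_conj // va.
have s1 : s + conj s + 0 * conj 0 = 0.
  rewrite mul0r addr0 /s rmorphB rmorphN !rmorphM /= conjK fmorphV rmorph_nat conj_wX.
  have -> : conj x = - (y * conj y) - x by rewrite -[RHS]addr0 -xy; ring.
  by rewrite ca aE; field; rewrite ?y0 ?cy0 ?K2.
have torK : Kn (mkU3 (torus_unitary conjK a0)).
  rewrite /Kgroup /= !mkU3E !mxE /= subrr; split; split=> //.
    by right; rewrite va.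
  by right; rewrite valV ?val_conj ?fmorph_eq0 // va.
apply: (@covered_same_row _ (gam i)
  (mkU3 (torus_unitary conjK a0) * mkU3 (lower_unitary conjK s1))%g (conj a)^-1).
- by apply: Kgroup_mul => //; apply: lowerK.
- exists i, 1%g, 1%g; split=> //; [by lia| |exact: Kgroup_one|by rewrite mulg1 mul1g].
  by apply/borelP; rewrite !U3_1 !mxE.
rewrite mulgA.
apply: ord3_ind; rewrite !U3ME !gammaE !mkU3E !mxE /= /s ca aE ?rmorph0;
  by field; rewrite ?oppr_eq0 ?y0 ?cy0 ?K2 ?wi0.
Qed.

(** If the bottom row (x, y, z) has x / z in p^n, scaling by z^-1 reduces to [covered_lower].
    Otherwise v(z) >= v(x) - n, and the Weyl element of K_n brings the row to the former case. *)
Lemma coset_cover g : covered g.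
Proof.
have main h z : h 2 2 != 0 -> z = h 2 2 -> pideal v (n%:Z + v z) (h 2 0) -> covered h.
  move=> h0 zE hz; rewrite -zE in h0.
  have xy : h 2 0 / z + conj (h 2 0 / z) + h 2 1 / z * conj (h 2 1 / z) = 0.
    have := U3_rows h 2 0; rewrite !rev_ord3 -zE /= => E.
    have cz0 : conj z != 0 by rewrite fmorph_eq0.
    rewrite !(rmorphM conj) fmorphV.
    transitivity ((h 2 0 * conj z + h 2 1 * conj (h 2 1) + z * conj (h 2 0)) / (z * conj z)).
      by field; rewrite h0 cz0.
    by rewrite E mul0r.
  apply: (@covered_same_row _ _ 1%g z (Kgroup_one n) (covered_lower xy _)).
    apply: (pMW hz (n := - v z)); last by lia.
    by right; rewrite valV.
  by rewrite mulg1; apply: ord3_ind; rewrite mkU3E !mxE /= -?zE; field.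
have flip : g 2 0 != 0 -> pideal v (v (g 2 0) - n%:Z) (g 2 2) -> covered g.
  move=> x0 pz; have [wn0 vwn] := val_wX n%:Z.
  have wK : Kn (mkU3 (weyl_unitary wn0 (conj_wX n%:Z))).
    have p0 m : pideal v m 0 by left.
    rewrite /Kgroup /= !mkU3E !mxE /= subrr; split; split=> //.
      by right; rewrite valV // vwn.
    exact: pideal_wX.
  rewrite -[g](mulgK (mkU3 (weyl_unitary wn0 (conj_wX n%:Z)))) -[X in (X * _)%g]mul1g.
  apply: covered_borel_mul_Kgroup; last 1 first.
  - apply: (main _ _ _ erefl); rewrite !U3ME !mkU3E !mxE /= !(mulr0, mulr1, add0r, addr0).
      by rewrite mulf_neq0 ?invr_eq0.
    rewrite valM ?invr_eq0 // valV // vwn.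
    by apply: (pMW pz (pideal_wX n%:Z)); lia.
  - by apply/borelP; rewrite !U3_1 !mxE.
  - exact: Kgroup_inv.
have [z0|z0] := eqVneq (g 2 2) 0.
  have y0 : g 2 1 = 0.
    have := U3_rows g 2 0; rewrite !rev_ord3 z0 rmorph0 mulr0 mul0r add0r addr0.
    by move=> /eqP; rewrite mulf_eq0 fmorph_eq0 orbb => /eqP.
  apply: flip; last by rewrite z0; left.
  apply/eqP => x0; have := U3_rows g 2 2; rewrite x0 y0 z0 !mul0r !addr0.
  by move/eqP; rewrite eq_sym oner_eq0.
have [px|npx] := pselect (pideal v (n%:Z + v (g 2 2)) (g 2 0)).
  exact: (main g (g 2 2)).
have x0 : g 2 0 != 0 by apply/eqP => x0; apply: npx; rewrite x0; left.
apply: flip => //; right; rewrite leNgt; apply/negP => lt.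
by apply: npx; right; lia.
Qed.
End DoubleCosets.

(** * Fixed vectors of the induced representation *)

Lemma has_dim_reindex (K : fieldType) (V : lmodType K) (W : set V)
    (I : choiceType) (A : set I) (e : I -> V) (d : nat) (h : 'I_d -> I) :
  is_basis W A e -> injective h -> A = range h -> has_dim W d.
Proof.
move=> [We indep spans] hI Ah; exists (e \o h); split=> /=.
- by move=> j _; apply: We; rewrite Ah; exists j.
- move=> s a us _ sum0 j js.
  (* The coefficients transported along h, extended by 0 outside its range. *)
  pose a' i := if [pick j | h j == i] is Some j then a j else 0.
  have a'E j' : a' (h j') = a j'.
    by rewrite /a'; case: pickP => [k /eqP/hI -> //|/(_ j')]; rewrite eqxx.
  rewrite -a'E; apply: (indep (map h s)); last exact: map_f.
  + by rewrite map_inj_uniq.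
  + by move=> i /mapP[k _ ->]; rewrite Ah; exists k.
  by rewrite big_map -[RHS]sum0; apply: eq_bigr => k _; rewrite a'E.
- move=> x /spans[s [a [sA ->]]].
  have [s' ->] : exists s', s = map h s'.
    elim: s sA => [|i s IHs] sA; first by exists [::].
    have [|s' ->] := IHs; first by move=> k ks; apply: sA; rewrite inE ks orbT.
    have := sA i (mem_head _ _); rewrite Ah => -[j _ <-].
    by exists (j :: s').
  by exists s', (a \o h); split=> //; rewrite big_map.
Qed.

Section InducedRepresentation.
Context (R : realType).
Context (K : fieldType) (v : K -> int) (v_val : discrete_valuation v).
Context (residue_gt0 : (0 < residue_card v)%N).
Context (conj : {rmorphism K -> K}) (conjK : involutive conj).
Context (val_conj : forall x : K, x != 0 -> v (conj x) = v x).
Context (K2 : 2%:R != 0 :> K) (v2 : v 2%:R = 0).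
Context (w : K) (w0 : w != 0) (vw : v w = 1) (cw : conj w = w).
Context (mu1 mu2 : K -> R[i]).
Context (mu1_char : quasi_character v [set x | x != 0] mu1).
Context (mu2_char : quasi_character v (norm_one conj) mu2).
Implicit Types (b g k : U3 conj) (i j : int) (n : nat) (f : U3 conj -> R[i]^o).

Let c1 := conductor1 v mu1.
Let c2 := conductor2 v conj mu2.
Let gam i := gamma conj w i.
Let V n := fixed_vectors v (induced v conj mu1 mu2) n.

Definition borel_char b : R[i] :=
  (Num.sqrt (modulusB R v b))%:C * muB mu1 mu2 b.

Let chi := borel_char.

Lemma sqrt_modulusB b : Num.sqrt (modulusB R v b) = absval R v (b 0 0).
Proof.
rewrite /modulusB sqrtr_sqr ger0_norm // /absval; case: ifP => // _.
by apply: exprz_ge0.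
Qed.

Lemma borel_entries b : borel conj b -> b 0 0 != 0 /\ norm_one conj (b 1 1).
Proof.
move=> /borel_diag[b00 b11]; split=> //.
by apply: contra_eq_neq b00 => ->; rewrite mul0r eq_sym oner_neq0.
Qed.

Lemma borel_char_neq0 b : borel conj b -> chi b != 0.
Proof.
move=> /borel_entries[b00 b11]; rewrite /chi /borel_char sqrt_modulusB /muB.
have [mu1N _ _] := mu1_char; have [mu2N _ _] := mu2_char.
rewrite !mulf_neq0 ?mu1N ?mu2N // fmorph_eq0 /absval (negPf b00).
by rewrite expfz_neq0 // pnatr_eq0 -lt0n.
Qed.

Lemma borel_charM b b' : borel conj b -> borel conj b' ->
  chi (b * b')%g = chi b * chi b'.
Proof.
move=> bB bB'; have [E0 E1] := borel_diagM bB bB'.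
have [b00 b11] := borel_entries bB; have [b00' b11'] := borel_entries bB'.
rewrite /chi /borel_char !sqrt_modulusB /muB E0 E1.
have [_ mu1M _] := mu1_char; have [_ mu2M _] := mu2_char.
rewrite mu1M // mu2M // /absval mulf_eq0 (negPf b00) (negPf b00') /=.
rewrite valM // opprD expfzDr ?pnatr_eq0 -?lt0n // rmorphM /=.
by ring.
Qed.

Lemma borel_char_unit b : borel conj b -> v (b 0 0) = 0 ->
  chi b = mu1 (b 0 0) * mu2 (b 1 1).
Proof.
move=> /borel_entries[b00 _] vb.
by rewrite /chi /borel_char sqrt_modulusB /absval (negPf b00) vb expr0z mul1r.
Qed.

Lemma fixed_eval n f b g k : V n f -> borel conj b -> Kgroup v conj n k ->
  f (b * g * k)%g = chi b * f g.
Proof.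
move=> [[_ fB] fK] bB kK; rewrite -fB //.
exact: (congr1 (fun f => f (b * g)%g) (fK k kK)).
Qed.

(** Evaluating f at b gamma_i = gamma_i k in two ways gives chi(b) = 1; the explicit stabilizers
    turn this into triviality of mu1 and mu2 at the levels n - i and 2i - n. *)
Lemma fixed_support n f i : V n f -> n%:Z <= 2 * i -> i <= n%:Z ->
  f (gam i) != 0 -> n%:Z + c2%:Z <= 2 * i /\ i <= n%:Z - c1%:Z.
Proof.
move=> fV ni iN fi.
have chi1 b k : borel conj b -> Kgroup v conj n k ->
    (b * gam i)%g = (gam i * k)%g -> chi b = 1.
  move=> bB kK bk; apply: (mulIf fi); rewrite mul1r.
  rewrite -(fixed_eval _ fV bB (Kgroup_one v_val conj n)) mulg1 bk.
  have B1 : borel conj 1%g by apply/borelP; rewrite !U3_1 !mxE.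
  have chi1 : chi 1%g = 1.
    apply: (mulfI (borel_char_neq0 B1)).
    by rewrite -borel_charM // !mulg1 mulr1.
  by rewrite -[gam i]mul1g (fixed_eval _ fV B1 kK) chi1 mul1r mul1g.
have mu11 : mu1 1 = 1 by apply: (quasi_character1 mu1_char); apply: oner_neq0.
have mu21 : mu2 1 = 1.
  by apply: (quasi_character1 mu2_char); rewrite /norm_one /= rmorph1 mulr1.
split.
  suff : (c2 <= `|(2 * i - n%:Z)%R|)%N by lia.
  apply/(conductor2P v_val mu2_char) => d dP.
  have [d1 pd] : norm_one conj d /\ pideal v (2 * i - n%:Z) (d - 1).
    (* At level 0 the congruence is absent from the definition, but it holds because d is a unit. *)
    move: dP; rewrite /norm_one_filtration; case: eqP => [m0 d1|_ [d1 /= pd]].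
      split=> //; have [d0 vd] := norm_one_unit v_val val_conj d1.
      by apply: pidealB => //; right; rewrite ?vd ?val1 //; lia.
    by split=> //; apply: pidealW pd; lia.
  have [b [k [bB kK bk b00 b11]]] :=
    stab_middle v_val K2 v2 w0 vw cw ni iN d1 pd.
  have := chi1 _ _ bB kK bk; rewrite borel_char_unit // b00 ?val1 // b11.
  by rewrite mu11 mul1r.
suff : (c1 <= `|(n%:Z - i)%R|)%N by lia.
apply/(conductor1P v_val mu1_char) => a pa [a0 va].
have {}pa : pideal v (n%:Z - i) (a - 1) by apply: pidealW pa; lia.
have [b [k [bB kK bk b00 b11]]] :=
  stab_torus v_val val_conj conjK K2 v2 w0 vw cw ni iN a0 va pa.
have := chi1 _ _ bB kK bk; rewrite borel_char_unit // b00 // b11.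
by rewrite mu21 mulr1.
Qed.

(** * Existence of f_{n,i} *)

Lemma borel_char_stabilizer n i b k :
  n%:Z + c2%:Z <= 2 * i -> i <= n%:Z - c1%:Z ->
  borel conj b -> Kgroup v conj n k -> (b * gam i)%g = (gam i * k)%g -> chi b = 1.
Proof.
move=> ni iN bB kK bk.
have [| |v00 p00 p11] := coset_stabilizer v_val val_conj conjK K2 v2 w0 vw cw _ _ bB kK bk.
- by lia.
- by lia.
have [b00 b11] := borel_entries bB.
rewrite borel_char_unit //.
have /(conductor1P v_val mu1_char) -> // : (c1 <= `|(n%:Z - i)%R|)%N by lia.
  have /(conductor2P v_val mu2_char) -> // : (c2 <= `|(2 * i - n%:Z)%R|)%N by lia.
    by rewrite mulr1.
  rewrite /norm_one_filtration; case: eqP => // _; split=> //=.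
  by apply: pidealW p11; lia.
by apply: pidealW p00; lia.
Qed.

(** The candidate for f_{n,i}: b gamma_i k is sent to chi(b), and 0 is the default off the double
    coset. Independence of the chosen b and k is [coset_funE]. *)
Definition coset_fun n i g : R[i]^o :=
  xget 0 [set c | exists b k, [/\ borel conj b, Kgroup v conj n k,
    g = (b * gam i * k)%g & c = chi b]].

Section CosetFunction.
Context (n : nat) (i : int).
Context (ni : n%:Z + c2%:Z <= 2 * i) (iN : i <= n%:Z - c1%:Z).

Lemma coset_funE b k : borel conj b -> Kgroup v conj n k ->
  coset_fun n i (b * gam i * k)%g = chi b.
Proof.
move=> bB kK; rewrite /coset_fun; case: xgetP => [c _|/(_ (chi b))]; last first.
  by case; exists b, k.
move=> [b' [k' [bB' kK' E ->]]].
have B := borelM (borelV bB') bB.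
have <- : chi b' * chi (b'^-1 * b)%g = chi b by rewrite -borel_charM // mulVKg.
have kK2 := Kgroup_mul v_val kK' (Kgroup_inv val_conj kK).
rewrite (borel_char_stabilizer ni iN B kK2) ?mulr1 //.
by apply: (mulgI b'); rewrite !mulgA mulgV mul1g -E mulgK.
Qed.

Lemma coset_fun_support g : coset_fun n i g != 0 ->
  exists b k, [/\ borel conj b, Kgroup v conj n k & g = (b * gam i * k)%g].
Proof.
rewrite /coset_fun; case: xgetP => [c _ [b [k [bB kK -> _]]] _|_].
  by exists b, k.
by rewrite eqxx.
Qed.

Lemma coset_fun_is_fni : is_fni v mu1 mu2 w n i (coset_fun n i).
Proof.
have B1 : borel conj 1%g by apply/borelP; rewrite !U3_1 !mxE.
have K1 := Kgroup_one v_val conj n.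
have fB b g : borel conj b -> coset_fun n i (b * g)%g = chi b * coset_fun n i g.
  move=> bB; have [g0|/coset_fun_support[b' [k [bB' kK ->]]]] := eqVneq (coset_fun n i g) 0.
    (* Were bg in the double coset, g would be too, and its value would be a value of chi, hence
       non-zero. *)
    rewrite g0 mulr0; apply/eqP/negPn/negP => /coset_fun_support[b' [k [bB' kK E]]].
    case/negP: (borel_char_neq0 (borelM (borelV bB) bB')).
    rewrite -(coset_funE (borelM (borelV bB) bB') kK) -g0; apply/eqP.
    by rewrite -[in RHS](mulKg b g) E !mulgA.
  by rewrite !mulgA !coset_funE //; [apply: borel_charM|apply: borelM].
have fK g k : Kgroup v conj n k -> coset_fun n i (g * k)%g = coset_fun n i g.
  move=> kK; have kV := Kgroup_inv val_conj kK.
  have [g0|/coset_fun_support[b [k' [bB kK' ->]]]] := eqVneq (coset_fun n i g) 0.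
    rewrite g0; apply/eqP/negPn/negP => /coset_fun_support[b [k' [bB kK' E]]].
    case/negP: (borel_char_neq0 bB).
    rewrite -(coset_funE bB (Kgroup_mul v_val kK' kV)) -g0; apply/eqP.
    by rewrite -[in RHS](mulgK k g) E !mulgA.
  by rewrite -mulgA !coset_funE //; apply: Kgroup_mul.
have f1 : coset_fun n i (gam i) = 1.
  rewrite -[gam i]mul1g -[(1 * _)%g]mulg1 coset_funE //.
  by apply: (mulfI (borel_char_neq0 B1)); rewrite -borel_charM // !mulg1 mulr1.
split=> //.
- split; last by move=> k kK; apply/funext => g; apply: fK.
  split=> [g|b g bB]; last exact: fB.
  (* Local constancy: any h close to g lies in g K_n. *)
  have [m mP] := Kgroup_open v_val n g; exists m => h /mP hK.
  by rewrite -(fK g _ hK) mulVKg.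
- apply/seteqP; split=> g /=.
    by move/coset_fun_support => [b [k [bB kK ->]]]; exists b => //; exists k.
  by move=> [b bB [k kK <-]]; rewrite coset_funE //; apply: borel_char_neq0.
Qed.

Lemma fniP : is_fni v mu1 mu2 w n i (fni v conj mu1 mu2 w n i).
Proof. by apply: (xgetPex _ (ex_intro _ _ coset_fun_is_fni)). Qed.

End CosetFunction.

(** * Basis and dimension *)

Let A n := [set i : int | n%:Z + c2%:Z <= 2 * i /\ i <= n%:Z - c1%:Z].

(** The evaluations at the gamma_j are dual to the f_{n,i}; this gives both independence and the
    coefficients of an expansion. *)
Lemma fni_gamma n i j : A n i -> A n j ->
  fni v conj mu1 mu2 w n i (gam j) = (i == j)%:R.
Proof.
move=> [ni iN] [nj jN]; have [_ f1 fS] := fniP ni iN.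
have [<-//|ij] := eqVneq i j.
apply/eqP/negPn/negP => fj; case/negP: ij; apply/eqP.
have : [set g | fni v conj mu1 mu2 w n i g != 0] (gam j) by [].
rewrite fS => -[b bB [k kK E]].
apply: (coset_disjoint v_val val_conj conjK K2 v2 w0 vw cw _ _ _ _ bB
  (Kgroup_inv val_conj kK)); try by lia.
by rewrite -/(gam j) -E mulgK.
Qed.

(** i and b do not depend on f, so a vector and its expansion can be compared at g with the same
    factor chi(b). *)
Lemma fixed_cover n g : exists i b, [/\ n%:Z <= 2 * i, i <= n%:Z,
  borel conj b & forall f, V n f -> f g = chi b * f (gam i)].
Proof.
have [i [b [k [ni iN bB kK ->]]]] := coset_cover v_val val_conj conjK K2 v2 w0 vw cw n g.
by exists i, b; split=> // f fV; apply: fixed_eval fV bB kK.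
Qed.

Lemma fni_basis n : is_basis (V n) (A n) (fni v conj mu1 mu2 w n).
Proof.
have sumE (s : seq int) (a : int -> R[i]) g :
    (\sum_(i <- s) a i *: fni v conj mu1 mu2 w n i) g =
    \sum_(i <- s) a i * fni v conj mu1 mu2 w n i g.
  by rewrite fct_sumE; apply: eq_bigr.
have sum_gamma (s : seq int) (a : int -> R[i]) j :
    uniq s -> (forall i, i \in s -> A n i) -> j \in s ->
    (\sum_(i <- s) a i *: fni v conj mu1 mu2 w n i) (gam j) = a j.
  move=> us sA js; rewrite sumE (bigD1_seq j) //= fni_gamma ?eqxx ?mulr1; try exact: sA.
  rewrite big_seq_cond big1 ?addr0 // => i /andP[/sA Ai /negPf ij].
  by rewrite fni_gamma ?ij ?mulr0 //; apply: sA.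
split.
- by move=> i [ni iN]; have [] := fniP ni iN.
- by move=> s a us sA s0 j js; rewrite -(sum_gamma s a j us sA js) s0.
move=> f fV.
(* An enumeration of [A n], whose members all lie between 0 and n. *)
pose s : seq int := [seq i <- [seq m%:Z | m : nat <- iota 0 n.+1] |
  (n%:Z + c2%:Z <= 2 * i) && (i <= n%:Z - c1%:Z)].
have sP i : i \in s <-> A n i.
  rewrite mem_filter; split=> [/andP[/andP[? ?] _] //|[ni iN]].
  rewrite ni iN !andTb; apply/mapP; exists `|i|%N; last by lia.
  by rewrite mem_iota; lia.
have us : uniq s by rewrite filter_uniq // map_inj_uniq ?iota_uniq // => ? ? [].
exists s, (fun i => f (gam i)); split=> [i /sP //|].
apply/funext => g; have [j [b [nj jN bB ev]]] := fixed_cover n g.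
rewrite (ev f fV) sumE.
have [js|js] := boolP (j \in s).
  rewrite -[in LHS](sum_gamma s (fun i => f (gam i)) j) // ?sumE; last by move=> i /sP.
  rewrite mulr_sumr big_seq [RHS]big_seq; apply: eq_bigr => i /sP[ni iN].
  have [iV _ _] := fniP ni iN.
  by rewrite (ev _ iV) mulrCA.
(* For j outside [A n], [fixed_support] makes every fixed vector vanish at gamma_j: f here, and each
   f_{n,i} below. *)
have fj : f (gam j) = 0.
  apply/eqP/negPn/negP => fj; case/negP: js; apply/sP.
  exact: (fixed_support fV nj jN fj).
rewrite fj mulr0 big_seq big1 // => i /[dup] si /sP[ni iN].
have [iV _ _] := fniP ni iN; rewrite (ev _ iV).
suff -> : fni v conj mu1 mu2 w n i (gam j) = 0 by rewrite !mulr0.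
apply/eqP/negPn/negP => ij; case/negP: js; apply/sP.
exact: (fixed_support iV nj jN ij).
Qed.

(** An index satisfies n + c2 <= 2i <= 2n - 2 c1, so it exists only if 2 c1 + c2 <= n; conversely i
    = n - c1 is then admissible. *)
Lemma fixed_neq0 n : V n <> [set 0] <-> (2 * c1 + c2 <= n)%N.
Proof.
split=> [V0|le].
  rewrite leqNgt; apply/negP => lt; apply: V0; apply/seteqP; split=> [f fV|f ->] /=.
    have [_ _ spans] := fni_basis n.
    have [[|i s] [a [sA ->]]] := spans f fV; first by rewrite big_nil.
    by have [] := sA i (mem_head _ _); lia.
  split; last by move=> k _; apply/funext.
  split=> [g|b g _]; first by exists 0.
  by rewrite /= mulr0.
move=> V0; have Ai : A n (n%:Z - c1%:Z) by split; lia.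
have [W _ _] := fni_basis n.
have := W _ Ai; rewrite V0 => f0.
have := fni_gamma Ai Ai; rewrite f0 eqxx => /esym/eqP.
by rewrite oner_eq0.
Qed.

(** Counted downwards from n - c1: the index n - c1 - j is admissible exactly when 2j <= n - (2 c1 +
    c2). *)
Lemma fixed_dim n : (2 * c1 + c2 <= n)%N ->
  has_dim (V n) ((n - (2 * c1 + c2)) %/ 2 + 1)%N.
Proof.
move=> le; set d := (_ + 1)%N.
apply: (has_dim_reindex (h := fun j : 'I_d => n%:Z - c1%:Z - j%:Z) (fni_basis n)).
  by move=> j j' E; apply: val_inj => /=; lia.
apply/seteqP; split=> i /=; last first.
  by move=> [[j jd] _ <-] /=; split; rewrite /d in jd; lia.
move=> [ni iN]; have jd : (`|(n%:Z - c1%:Z - i)%R| < d)%N by rewrite /d; lia.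
by exists (Ordinal jd) => //=; lia.
Qed.

End InducedRepresentation.

(** If 2 were in the maximal ideal, so would be 1 = p - 2 (p - 1)/2. *)
Lemma odd_residue_val2 (F : fieldType) (vF : F -> int) (p : nat) :
  discrete_valuation vF -> residue_pchar vF p -> odd p ->
  2%:R != 0 :> F -> vF 2%:R = 0.
Proof.
move=> vF_val [_ pp] p_odd F2; have [//|v2] := eqVneq (vF 2%:R) 0.
have /(pidealP _ _ F2) : pideal vF 0 2%:R by apply: pideal_nat.
move=> v2ge; have p2 : pideal vF 1 2%:R by right; lia.
have /(pidealP _ _ (oner_neq0 F)) : pideal vF 1 1; last by rewrite val1.
have -> : 1 = p%:R - p./2%:R * 2%:R :> F.
  by rewrite -[X in X%:R - _]odd_double_half p_odd -muln2 natrD natrM addrK.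
by apply: pidealB => //; apply: (pidealMW vF_val (pideal_nat vF_val _) p2).
Qed.

Unset Implicit Arguments.

Theorem theorem2p4 (R : realType)
  (F : fieldType) (vF : F -> int) (F_local : local_field vF)
  (F_char0 : [pchar F] =i pred0)
  (p : nat) (p_res : residue_pchar vF p) (p_odd : odd p)
  (E : fieldExtType F) (E_quadratic : \dim {: E} = 2%N)
  (vE : E -> int) (vE_val : discrete_valuation vE)
  (E_unram : unramified vF vE)
  (conj : {lrmorphism E -> E}) (conj_nontrivial : exists x, conj x <> x)
  (w : F) (w_unif : uniformizer vF w)
  (mu1 mu2 : E -> R[i])
  (mu1_char : quasi_character vE [set x | x != 0] mu1)
  (mu2_char : quasi_character vE (norm_one conj) mu2) :
  let V := induced vE conj mu1 mu2 in
  let N := rep_conductor vE V in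
  let c1 := conductor1 vE mu1 in
  let c2 := conductor2 vE conj mu2 in
  [/\ exists n : nat, fixed_vectors vE V n <> [set 0],
      N = (2 * c1 + c2)%N
    & forall n : nat, (N <= n)%N ->
        is_basis (fixed_vectors vE V n)
          [set i : int | n%:Z + c2%:Z <= 2 * i /\ i <= n%:Z - c1%:Z]
          (fni vE conj mu1 mu2 w%:A n) /\
        has_dim (fixed_vectors vE V n) ((n - N) %/ 2 + 1)%N].
Proof.
move=> V N c1 c2.
have vF_val : discrete_valuation vF by case: F_local.
have [w0 vw] := w_unif.
have F2 : 2%:R != 0 :> F by move/pcharf0P: F_char0 => ->.
have E2E : 2%:R = (2%:R : F)%:A :> E by rewrite scaler_nat.
have E2 : 2%:R != 0 :> E by rewrite E2E scalar_eq0.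
have v2 : vE 2%:R = 0.
  by rewrite E2E E_unram // (@odd_residue_val2 _ _ _ vF_val p_res).
have wA0 : w%:A != 0 :> E by rewrite scalar_eq0.
have vwA : vE w%:A = 1 by rewrite E_unram.
have cK := conjK E_quadratic conj_nontrivial.
have vc (x : E) := @val_conj _ _ F_local _ E_quadratic _ vE_val E_unram _ conj_nontrivial x.
have q0 := residue_card_gt0 F_local E_quadratic vE_val E_unram.
have neq0 n : fixed_vectors vE V n <> [set 0] <-> (2 * c1 + c2 <= n)%N.
  exact: (fixed_neq0 vE_val q0 cK vc E2 v2 wA0 vwA (conj_scalar conj w) mu1_char mu2_char).
(* A member of the set is required for [nat_min] to be its minimum and not the default 0. *)
have exN : [set n | fixed_vectors vE V n <> [set 0]] (2 * c1 + c2)%N by apply/neq0.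
have NE : N = (2 * c1 + c2)%N.
  have [/neq0 le min] := nat_minP (ex_intro _ _ exN).
  by apply/eqP; rewrite eqn_leq le andbT; apply: min.
split=> //; first by exists (2 * c1 + c2)%N.
move=> n; rewrite NE => le; split.
  exact: (fni_basis vE_val q0 cK vc E2 v2 wA0 vwA (conj_scalar conj w) mu1_char mu2_char).
exact: (fixed_dim vE_val q0 cK vc E2 v2 wA0 vwA (conj_scalar conj w) mu1_char mu2_char).
Qed.
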